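(* Assume that the continuum hypothesis fails, i.e. $\aleph_1 < 2^{\aleph_0}$. Then there exist $\mathrm{C}^*$-algebras $A$ and $B$, each of density character at most $2^{\aleph_0}$, such that $A \equiv B$ (elementary equivalence in continuous logic), but for all non-principal ultrafilters $\mathcal{U}, \mathcal{V}$ on $\omega$ the ultrapowers $A^{\mathcal{U}}$ and $B^{\mathcal{V}}$ are not isomorphic.
   Context: The density character of a metric space is the least cardinality of a dense subset. $\mathrm{C}^*$-algebras are regarded as metric structures in continuous logic in the usual way: quantifiers range over norm-closed balls of the algebra; terms are complex $*$-polynomials; atomic formulas are norms $\|t(\bar x)\|$ of terms; formulas are built from atomic formulas by applying continuous functions $\mathbb{R}^n \to \mathbb{R}$ and the quantifiers $\sup$ and $\inf$ over balls. Sentences are formulas without free variables, and each sentence $\sigma$ takes a real value $\sigma^A$ in each $\mathrm{C}^*$-algebra $A$. $A \equiv B$ means $\sigma^A = \sigma^B$ for every sentence $\sigma$. For an ultrafilter $\mathcal{U}$ on $\omega$, the ultrapower is $A^{\mathcal{U}} = \ell^\infty(\omega, A)/\{(a_n)_n : \lim_{n\to\mathcal{U}} \|a_n\| = 0\}$. Isomorphism means $*$-isomorphism. *)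

(* Defs.v *)
From HB Require Import structures.
From mathcomp Require Import all_boot all_order all_algebra.
From mathcomp Require Import generic_quotient ring_quotient.
From mathcomp Require Import complex.
From mathcomp Require Import all_classical all_reals all_analysis.

Set Implicit Arguments.
Unset Strict Implicit.
Unset Printing Implicit Defensive.

Import Order.TTheory GRing.Theory Num.Theory.
Import numFieldNormedType.Exports.

Local Open Scope classical_set_scope.
Local Open Scope quotient_scope.
Local Open Scope card_scope.
Local Open Scope complex_scope.
Local Open Scope ring_scope.

Reserved Notation "x ** y" (at level 40, left associativity).

(* Complex *-algebras, not necessarily unital: hence not built on the ring
   structures of the library, which carry a unit. *)
HB.mixin Record Lmodule_isStarAlgebra (R : realType) A
    of GRing.Lmodule R[i] A := {
  smul : A -> A -> A ;
  star : A -> A ;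
  smulA : associative smul ;
  smulDl : left_distributive smul +%R ;
  smulDr : right_distributive smul +%R ;
  smulZl : forall (c : R[i]) x y, smul (c *: x) y = c *: smul x y ;
  smulZr : forall (c : R[i]) x y, smul x (c *: y) = c *: smul x y ;
  starK : involutive star ;
  starD : {morph star : x y / x + y} ;
  starZ : forall (c : R[i]) x, star (c *: x) = c^* *: star x ;
  starM : forall x y, star (smul x y) = smul (star y) (star x)
}.

#[short(type="starAlgType")]
HB.structure Definition StarAlgebra (R : realType) :=
  { A of GRing.Lmodule R[i] A & Lmodule_isStarAlgebra R A }.

Notation "x ** y" := (smul x y) : ring_scope.

HB.mixin Record StarAlgebra_isCstarAlgebra (R : realType) A
    of StarAlgebra R A & CompleteNormedModule R[i] A := {
  cstar_normM : forall x y : A, `|x ** y| <= `|x| * `|y| ;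
  cstar_identity : forall x : A, `|star x ** x| = `|x| ^+ 2
}.

#[short(type="cstarAlgType")]
HB.structure Definition CstarAlgebra (R : realType) :=
  { A of StarAlgebra R A & CompleteNormedModule R[i] A
       & StarAlgebra_isCstarAlgebra R A }.

Section StarAlgebraTheory.
Variables (R : realType) (A : starAlgType R).
Implicit Types x y z : A.

Lemma smulr0 x : x ** 0 = 0.
Proof. by apply: (@addrI _ (x ** 0)); rewrite -smulDr !addr0. Qed.

Lemma smul0r x : 0 ** x = 0.
Proof. by apply: (@addrI _ (0 ** x)); rewrite -smulDl !addr0. Qed.

Lemma smulBr x y z : x ** (y - z) = x ** y - x ** z.
Proof. by rewrite smulDr -scaleN1r smulZr scaleN1r. Qed.

Lemma smulBl x y z : (x - y) ** z = x ** z - y ** z.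
Proof. by rewrite smulDl -scaleN1r smulZl scaleN1r. Qed.

Lemma starN x : star (- x) = - star x.
Proof. by rewrite -scaleN1r starZ rmorphN rmorph1 scaleN1r. Qed.

Lemma starB x y : star (x - y) = star x - star y.
Proof. by rewrite starD starN. Qed.

Lemma star0 : star (0 : A) = 0.
Proof. by rewrite -[X in star X](scale0r (0 : A)) starZ rmorph0 scale0r. Qed.

End StarAlgebraTheory.

Definition star_isomorphic (R : realType) (A B : starAlgType R) : Prop :=
  exists f : {linear A -> B},
    [/\ bijective f,
        {morph f : x y / x ** y} &
        {morph f : x / star x}].

(* In a normed module over R[i] the norm `|x| is an element of R[i]. *)
Definition cnorm (R : realType) (A : cstarAlgType R) (x : A) : R :=
  complex.Re `|x|.

Lemma normc_real (R : realType) (V : normedZmodType R[i]) (x : V) :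
  `|x| = (complex.Re `|x|)%:C.
Proof. by have := ger0_Im (normr_ge0 x); case: `|x| => a b /= ->. Qed.

Section CnormTheory.
Variables (R : realType) (A : cstarAlgType R).
Implicit Types x y : A.

Lemma cnormE x : `|x| = (cnorm x)%:C.
Proof. exact: normc_real. Qed.

Lemma cnorm_ge0 x : 0 <= cnorm x.
Proof. by rewrite -lecR -cnormE normr_ge0. Qed.

Lemma cnorm0 : cnorm (0 : A) = 0.
Proof. by rewrite /cnorm normr0. Qed.

Lemma cnormN x : cnorm (- x) = cnorm x.
Proof. by rewrite /cnorm normrN. Qed.

Lemma cnormD x y : cnorm (x + y) <= cnorm x + cnorm y.
Proof. by rewrite -lecR rmorphD /= -!cnormE ler_normD. Qed.

Lemma cnormM x y : cnorm (x ** y) <= cnorm x * cnorm y.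
Proof. by rewrite -lecR rmorphM /= -!cnormE cstar_normM. Qed.

Lemma cnormZ (c : R[i]) x : cnorm (c *: x) = complex.Re `|c| * cnorm x.
Proof.
by apply: (@complexI R); rewrite rmorphM /= -!cnormE normrZ [in LHS]normc_real.
Qed.

Lemma cnorm_star x : cnorm (star x) = cnorm x.
Proof.
have le_star y : cnorm y <= cnorm (star y).
  have [->|y0] := eqVneq (cnorm y) 0; first exact: cnorm_ge0.
  have yp : 0 < cnorm y by rewrite lt_def y0 cnorm_ge0.
  rewrite -(ler_pM2r yp) (le_trans _ (cnormM _ _)) //.
  suff -> : cnorm (star y ** y) = cnorm y * cnorm y by [].
  by apply: (@complexI R); rewrite rmorphM /= -!cnormE cstar_identity expr2.
by apply/eqP; rewrite eq_le le_star andbT -{2}(starK x) le_star.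
Qed.

End CnormTheory.

Section BoundedSequences.
Variables (R : realType) (A : cstarAlgType R).

Definition bounded_seq : {pred nat -> A} :=
  [pred a : nat -> A | `[< exists M : R, forall n, cnorm (a n) <= M >]].

Lemma bounded_seqP (a : nat -> A) :
  reflect (exists M : R, forall n, cnorm (a n) <= M) (a \in bounded_seq).
Proof. exact: asboolP. Qed.

Lemma bounded_seq_submod : submod_closed bounded_seq.
Proof.
split; first by apply/bounded_seqP; exists 0 => n; rewrite cnorm0.
move=> c a b /bounded_seqP[M aM] /bounded_seqP[N bN].
apply/bounded_seqP; exists (complex.Re `|c| * M + N) => n.
apply: (le_trans (cnormD _ _)); rewrite lerD// cnormZ ler_wpM2l//.
by have := normr_ge0 c; rewrite lecE => /andP[].
Qed.

HB.instance Definition _ :=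
  GRing.isSubmodClosed.Build R[i] (nat -> A) bounded_seq bounded_seq_submod.

Record linfty := Linfty { lseq :> nat -> A; _ : lseq \in bounded_seq }.

HB.instance Definition _ := [isSub for lseq].
HB.instance Definition _ := [Choice of linfty by <:].
HB.instance Definition _ := [SubChoice_isSubLmodule of linfty by <:].

Lemma linftyP (a : linfty) : exists M : R, forall n, cnorm (a n) <= M.
Proof. exact/bounded_seqP/(valP a). Qed.

Lemma linfty_eq (a b : linfty) : (forall n, a n = b n) -> a = b.
Proof. by move=> ab; apply/val_inj/funext. Qed.

Lemma linfty_mul_subproof (a b : linfty) :
  (fun n => a n ** b n) \in bounded_seq.
Proof.
have [M aM] := linftyP a; have [N bN] := linftyP b.
apply/bounded_seqP; exists (M * N) => n; rewrite (le_trans (cnormM _ _))//.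
by rewrite ler_pM ?cnorm_ge0.
Qed.

Lemma linfty_star_subproof (a : linfty) :
  (fun n => star (a n)) \in bounded_seq.
Proof.
have [M aM] := linftyP a.
by apply/bounded_seqP; exists M => n; rewrite cnorm_star.
Qed.

Definition linfty_mul a b := Linfty (linfty_mul_subproof a b).
Definition linfty_star a := Linfty (linfty_star_subproof a).

Fact linfty_mulA : associative linfty_mul.
Proof. by move=> a b c; apply: linfty_eq => n /=; rewrite smulA. Qed.
Fact linfty_mulDl : left_distributive linfty_mul +%R.
Proof. by move=> a b c; apply: linfty_eq => n /=; rewrite smulDl. Qed.
Fact linfty_mulDr : right_distributive linfty_mul +%R.
Proof. by move=> a b c; apply: linfty_eq => n /=; rewrite smulDr. Qed.
Fact linfty_mulZl (c : R[i]) a b : linfty_mul (c *: a) b = c *: linfty_mul a b.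
Proof. by apply: linfty_eq => n /=; rewrite smulZl. Qed.
Fact linfty_mulZr (c : R[i]) a b : linfty_mul a (c *: b) = c *: linfty_mul a b.
Proof. by apply: linfty_eq => n /=; rewrite smulZr. Qed.
Fact linfty_starK : involutive linfty_star.
Proof. by move=> a; apply: linfty_eq => n /=; rewrite starK. Qed.
Fact linfty_starD : {morph linfty_star : a b / a + b}.
Proof. by move=> a b; apply: linfty_eq => n /=; rewrite starD. Qed.
Fact linfty_starZ (c : R[i]) a : linfty_star (c *: a) = c^* *: linfty_star a.
Proof. by apply: linfty_eq => n /=; rewrite starZ. Qed.
Fact linfty_starM a b :
  linfty_star (linfty_mul a b) = linfty_mul (linfty_star b) (linfty_star a).
Proof. by apply: linfty_eq => n /=; rewrite starM. Qed.

HB.instance Definition _ := Lmodule_isStarAlgebra.Build R linfty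
  linfty_mulA linfty_mulDl linfty_mulDr linfty_mulZl linfty_mulZr
  linfty_starK linfty_starD linfty_starZ linfty_starM.

End BoundedSequences.

Arguments linfty {R} A.

Section Ultrapower.
Variables (R : realType) (A : cstarAlgType R).
Variables (U : set_system nat) (FU : UltraFilter U).

Definition null_seq : {pred linfty A} :=
  [pred a : linfty A | `[< cnorm (a n) @[n --> U] --> (0 : R) >]].

Lemma null_seqP (a : linfty A) :
  reflect (forall e : R, 0 < e -> U [set n | cnorm (a n) < e])
          (a \in null_seq).
Proof.
apply: (iffP (asboolP _)) => [/cvgrPdist_lt h e e0|h].
  have := h _ e0; apply: filterS => n /=.
  by rewrite sub0r normrN ger0_norm ?cnorm_ge0.
apply/cvgrPdist_lt => e e0; have := h _ e0; apply: filterS => n /=.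
by rewrite sub0r normrN ger0_norm ?cnorm_ge0.
Qed.

Lemma null_seq_zmod : zmod_closed null_seq.
Proof.
split=> [|a b /null_seqP ha /null_seqP hb]; apply/null_seqP => e e0.
  by apply: filterS filterT => n _ /=; rewrite cnorm0.
have e20 : 0 < e / 2 by rewrite divr_gt0.
apply: filterS2 (ha _ e20) (hb _ e20) => n /= an bn.
by rewrite (le_lt_trans (cnormD _ _))// cnormN [ltRHS]splitr ltrD.
Qed.

HB.instance Definition _ :=
  GRing.isZmodClosed.Build (linfty A) null_seq null_seq_zmod.

Lemma null_seqW (a b : linfty A) (K : R) :
  (forall n, cnorm (b n) <= K * cnorm (a n)) ->
  a \in null_seq -> b \in null_seq.
Proof.
move=> ba /null_seqP ha; apply/null_seqP => e e0.
have K0 : 0 < `|K| + 1 by rewrite ltr_wpDl.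
apply: filterS (ha _ (divr_gt0 e0 K0)) => n /=.
rewrite ltr_pdivlMr// mulrC; apply: le_lt_trans.
rewrite (le_trans (ba n))// ler_wpM2r ?cnorm_ge0//.
by rewrite (le_trans (ler_norm K))// lerDl.
Qed.

Lemma null_seqZ (c : R[i]) a : a \in null_seq -> c *: a \in null_seq.
Proof.
by apply: (@null_seqW _ _ (complex.Re `|c|)) => n /=; rewrite cnormZ.
Qed.

Lemma null_seqMl a b : b \in null_seq -> a ** b \in null_seq.
Proof.
have [M aM] := linftyP a; apply: (@null_seqW _ _ M) => n /=.
by rewrite (le_trans (cnormM _ _))// ler_wpM2r ?cnorm_ge0.
Qed.

Lemma null_seqMr a b : a \in null_seq -> a ** b \in null_seq.
Proof.
have [M bM] := linftyP b; apply: (@null_seqW _ _ M) => n /=.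
by rewrite (le_trans (cnormM _ _))// mulrC ler_wpM2r ?cnorm_ge0.
Qed.

Lemma null_seq_star a : a \in null_seq -> star a \in null_seq.
Proof. by apply: (@null_seqW _ _ 1) => n /=; rewrite mul1r cnorm_star. Qed.

Definition ultrapower : Type := {ideal_quot null_seq}.

HB.instance Definition _ := GRing.Zmodule.on ultrapower.
HB.instance Definition _ := EqQuotient.on ultrapower.

Lemma ultrapower_eqP (a b : linfty A) :
  reflect (\pi_ultrapower a = \pi_ultrapower b) (a - b \in null_seq).
Proof. by rewrite Quotient.idealrBE; apply: eqP. Qed.

Definition up_scale (c : R[i]) (x : ultrapower) : ultrapower :=
  \pi_ultrapower (c *: repr x).
Definition up_mul (x y : ultrapower) : ultrapower :=
  \pi_ultrapower (repr x ** repr y).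
Definition up_star (x : ultrapower) : ultrapower :=
  \pi_ultrapower (star (repr x)).

Lemma repr_pi_null (a : linfty A) : a - repr (\pi_ultrapower a) \in null_seq.
Proof. by apply/ultrapower_eqP; rewrite reprK. Qed.

Lemma pi_scale c a : up_scale c (\pi_ultrapower a) = \pi_ultrapower (c *: a).
Proof.
apply/esym/ultrapower_eqP; rewrite -scalerBr; exact/null_seqZ/repr_pi_null.
Qed.

Lemma pi_mul a b : up_mul (\pi_ultrapower a) (\pi_ultrapower b) =
  \pi_ultrapower (a ** b).
Proof.
set a' := repr (\pi_ultrapower a); set b' := repr (\pi_ultrapower b).
apply/esym/ultrapower_eqP.
have -> : a ** b - a' ** b' = (a - a') ** b + a' ** (b - b').
  by rewrite smulBl smulBr addrA subrK.
by apply: rpredD; [apply: null_seqMr|apply: null_seqMl]; apply: repr_pi_null.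
Qed.

Lemma pi_star a : up_star (\pi_ultrapower a) = \pi_ultrapower (star a).
Proof.
apply/esym/ultrapower_eqP; rewrite -starB; exact/null_seq_star/repr_pi_null.
Qed.

Lemma pi_addu a b :
  \pi_ultrapower a + \pi_ultrapower b = \pi_ultrapower (a + b).
Proof. by rewrite (Quotient.pi_add null_seq a b). Qed.

Fact up_scaleA c d x : up_scale c (up_scale d x) = up_scale (c * d) x.
Proof.
elim/quotW: x => a.
by rewrite (pi_scale d a) (pi_scale c (d *: a)) (pi_scale (c * d) a) scalerA.
Qed.
Fact up_scale1 : left_id 1 up_scale.
Proof. by elim/quotW=> a; rewrite (pi_scale 1 a) scale1r. Qed.
Fact up_scaleDr : right_distributive up_scale +%R.
Proof.
move=> c; elim/quotW=> a; elim/quotW=> b.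
by rewrite pi_addu (pi_scale c a) (pi_scale c b) (pi_scale c (a + b)) pi_addu
  scalerDr.
Qed.
Fact up_scaleDl x : {morph up_scale^~ x : c d / c + d}.
Proof.
elim/quotW: x => a c d.
by rewrite (pi_scale c a) (pi_scale d a) (pi_scale (c + d) a) pi_addu scalerDl.
Qed.

HB.instance Definition _ := GRing.Zmodule_isLmodule.Build R[i] ultrapower
  up_scaleA up_scale1 up_scaleDr up_scaleDl.

Lemma pi_scaleu (c : R[i]) a : c *: \pi_ultrapower a = \pi_ultrapower (c *: a).
Proof. exact: pi_scale. Qed.

Fact up_mulA : associative up_mul.
Proof.
elim/quotW=> a; elim/quotW=> b; elim/quotW=> c.
by rewrite (pi_mul b c) (pi_mul a b) (pi_mul a (b ** c)) (pi_mul (a ** b) c)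
  smulA.
Qed.
Fact up_mulDl : left_distributive up_mul +%R.
Proof.
elim/quotW=> a; elim/quotW=> b; elim/quotW=> c.
by rewrite pi_addu (pi_mul (a + b) c) (pi_mul a c) (pi_mul b c) pi_addu smulDl.
Qed.
Fact up_mulDr : right_distributive up_mul +%R.
Proof.
elim/quotW=> a; elim/quotW=> b; elim/quotW=> c.
by rewrite pi_addu (pi_mul a (b + c)) (pi_mul a b) (pi_mul a c) pi_addu smulDr.
Qed.
Fact up_mulZl (c : R[i]) x y : up_mul (c *: x) y = c *: up_mul x y.
Proof.
elim/quotW: x => a; elim/quotW: y => b.
by rewrite pi_scaleu (pi_mul (c *: a) b) (pi_mul a b) pi_scaleu smulZl.
Qed.
Fact up_mulZr (c : R[i]) x y : up_mul x (c *: y) = c *: up_mul x y.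
Proof.
elim/quotW: x => a; elim/quotW: y => b.
by rewrite pi_scaleu (pi_mul a (c *: b)) (pi_mul a b) pi_scaleu smulZr.
Qed.
Fact up_starK : involutive up_star.
Proof. by elim/quotW=> a; rewrite (pi_star a) (pi_star (star a)) starK. Qed.
Fact up_starD : {morph up_star : x y / x + y}.
Proof.
elim/quotW=> a; elim/quotW=> b.
by rewrite pi_addu (pi_star (a + b)) (pi_star a) (pi_star b) pi_addu starD.
Qed.
Fact up_starZ (c : R[i]) x : up_star (c *: x) = c^* *: up_star x.
Proof.
elim/quotW: x => a.
by rewrite pi_scaleu (pi_star (c *: a)) (pi_star a) pi_scaleu starZ.
Qed.
Fact up_starM x y : up_star (up_mul x y) = up_mul (up_star y) (up_star x).
Proof.
elim/quotW: x => a; elim/quotW: y => b.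
by rewrite (pi_mul a b) (pi_star (a ** b)) (pi_star a) (pi_star b)
  (pi_mul (star b) (star a)) starM.
Qed.

HB.instance Definition _ := Lmodule_isStarAlgebra.Build R ultrapower
  up_mulA up_mulDl up_mulDr up_mulZl up_mulZr
  up_starK up_starD up_starZ up_starM.

End Ultrapower.

Arguments ultrapower {R} A {U} FU.

Definition nonprincipal (U : set_system nat) : Prop := forall n, ~ U [set n].

(* Formulas of continuous logic with n free variables, numbered by 'I_n; a
   quantifier binds the variable ord0 and shifts the others. *)
Section ContinuousLogic.
Variable R : realType.

Inductive term (n : nat) : Type :=
| TVar of 'I_n
| TZero
| TAdd of term n & term n
| TScale of R[i] & term n
| TMul of term n & term n
| TStar of term n.

Inductive formula : nat -> Type :=
| FNorm n of term n : formula n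
| FConn n k (u : 'rV[R]_k -> R) of continuous u & ('I_k -> formula n) :
    formula n
| FSup n of {posnum R} & formula n.+1 : formula n
| FInf n of {posnum R} & formula n.+1 : formula n.

Definition sentence : Type := formula 0.

Definition env_cons (T : Type) n (x : T) (e : 'I_n -> T) (i : 'I_n.+1) : T :=
  if unlift ord0 i is Some j then e j else x.

Variable A : cstarAlgType R.

Fixpoint eval_term n (e : 'I_n -> A) (t : term n) : A :=
  match t with
  | TVar i => e i
  | TZero => 0
  | TAdd s t => eval_term e s + eval_term e t
  | TScale c t => c *: eval_term e t
  | TMul s t => eval_term e s ** eval_term e t
  | TStar t => star (eval_term e t)
  end.

Fixpoint eval_formula n (f : formula n) : ('I_n -> A) -> R :=
  match f in formula n return ('I_n -> A) -> R with
  | FNorm _ t => fun e => cnorm (eval_term e t)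
  | FConn _ _ u _ g => fun e => u (\row_i eval_formula (g i) e)
  | FSup _ r g => fun e =>
      sup [set eval_formula g (env_cons x e) | x in [set x | cnorm x <= r%:num]]
  | FInf _ r g => fun e =>
      inf [set eval_formula g (env_cons x e) | x in [set x | cnorm x <= r%:num]]
  end.

Definition eval_sentence (s : sentence) : R := eval_formula s (fun=> 0).

End ContinuousLogic.

Arguments TVar {R n}.
Arguments TZero {R n}.

Definition elementarily_equivalent (R : realType) (A B : cstarAlgType R) :
    Prop :=
  forall s : sentence R, eval_sentence A s = eval_sentence B s.

(* D is a dense subset of least cardinality, i.e. the density character of T is
   the cardinality of D. *)
Definition least_dense (T : topologicalType) (D : set T) : Prop :=
  dense D /\ forall E : set T, dense E -> D #<= E.

Definition density_le_continuum (T : topologicalType) : Prop :=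
  exists2 D : set T, least_dense D & D #<= [set: set nat].

(* X has cardinality aleph_1, the least uncountable cardinal. *)
Definition card_aleph1 (T : Type) (X : set T) : Prop :=
  ~ countable X /\ forall (S : Type) (Y : set S), ~ countable Y -> X #<= Y.

Definition card_lt (T S : Type) (X : set T) (Y : set S) : Prop :=
  X #<= Y /\ ~ (Y #<= X).

Definition aleph1_lt_continuum : Prop :=
  exists (T : Type) (X : set T), card_aleph1 X /\ card_lt X [set: set nat].

(* Main.v *)
(* For a directed strict order J without maximum, let A_J be the sup-norm
   closure of the functions on J * nat that depend only on which of finitely
   many elements of J lie above the first coordinate and on the second
   coordinate modulo some k, and that vanish where none of these elements
   does. The residues make every region splittable, so finite tuples of step
   functions with the same joint range satisfy the same formulas by back and
   forth; since formulas are uniformly continuous on balls and step functions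
   are dense, all the A_J are elementarily equivalent. If every countable
   family in J is bounded, each element of A_J has bounded support, and the
   indicators of the initial segments are units for all elements supported
   there. Take J1 of type aleph_1 and J2 of size at most the continuum in
   which every family indexed by J1 is bounded; the failure of CH provides it.
   In an ultrapower of A_J2 every J1-indexed family has a common unit, whereas
   in an ultrapower of A_J1 the J1-indexed family of indicators of initial
   segments has none. *)
Require Import Defs.
From HB Require Import structures.
From mathcomp Require Import all_boot all_order all_algebra.
From mathcomp Require Import complex ring lra.
From mathcomp Require Import all_classical all_reals all_analysis.
From mathcomp Require Import wochoice.

Set Implicit Arguments.
Unset Strict Implicit.
Unset Printing Implicit Defensive.

Import Order.TTheory GRing.Theory Num.Theory.
Import numFieldNormedType.Exports.

Local Open Scope classical_set_scope.
Local Open Scope card_scope.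

(** * Cardinals and directed orders *)

Lemma card_le_injP (T U : Type) (A : set T) (B : set U) :
  A #<= B <-> exists f : A -> B, injective f.
Proof.
split=> [/card_leP/injfunPex[f _ finj]|[f finj]].
  by exists f => x y; apply: finj; rewrite inE.
by apply/card_leP/injfunPex; exists f => // x y _ _; apply: finj.
Qed.

Lemma card_leT_injP (T U : Type) :
  [set: T] #<= [set: U] <-> exists f : T -> U, injective f.
Proof.
split=> [/card_le_injP[f finj]|[f finj]].
  exists (fun x => val (f (SigSub (mem_set (I : [set: T] x))))) => x y.
  by move=> /val_inj/finj/(congr1 val).
have /injfunPex[g] : exists2 f : T -> U, set_fun [set: T] [set: U] f &
  set_inj [set: T] f.
  by exists f => // x y _ _; apply: finj.
exact: inj_card_le g.
Qed.

Lemma card_le_setT (T : Type) (A : set T) : A #<= [set: A].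
Proof. by have := card_setT_sym A; rewrite card_eq_le => /andP[]. Qed.

(* A maximal set M of choice functions that pairwise differ everywhere must
   exhaust some E i, for otherwise it could be extended; then E i embeds into
   every E j through M. *)
Lemma least_cardinal (I : Type) (i0 : I) (E : I -> Type) :
  exists i, forall j, [set: E i] #<= [set: E j].
Proof.
pose P (M : set (forall i, E i)) :=
  forall f g, M f -> M g -> f <> g -> forall i, f i <> g i.
have [M [PM Mmax]] : exists M, P M /\ forall B, M `<` B -> ~ P B.
  apply: Zorn_bigcup => F FP Ftot f g [A FA Af] [B FB Bg] fg i.
  by have [AB|BA] := Ftot _ _ FA FB; [apply: (FP _ FB) fg i => //;
    apply: AB|apply: (FP _ FA) fg i => //; apply: BA].
have [[i isur]|nsur] := pselect (exists i, forall x : E i, exists2 f, M f &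
  f i = x).
  exists i => j; apply/card_leT_injP.
  have [h hP] : {h : E i -> forall i, E i & forall x, M (h x) /\ h x i = x}.
    by apply: (@choice _ _ (fun x f => M f /\ f i = x)) => x; have [f] :=
      isur x; exists f.
  exists (fun x => h x j) => x y hxy.
  rewrite -(hP x).2 -(hP y).2; have [->//|hne] := pselect (h x = h y).
  by case: (PM _ _ (hP x).1 (hP y).1 hne j hxy).
have [f fP] : exists f : forall i, E i, forall i g, M g -> g i <> f i.
  have nsur' i : exists x : E i, forall g, M g -> g i <> x.
    apply: contrapT => h; apply: nsur; exists i => x; apply: contrapT => h'.
    by apply: h; exists x => g Mg gx; apply: h'; exists g.
  have {}nsur' i : {x : E i | forall g, M g -> g i <> x} by apply: cid.
  by exists (fun i => sval (nsur' i)) => i; case: (nsur' i).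
case: (Mmax (M `|` [set f])).
  split; first by move=> g; left.
  by move=> /(_ f (or_intror erefl)) Mf; apply: (fP i0 f).
move=> g h [Mg|->] [Mh|->] gh i //; first exact: PM.
- exact: fP.
- by move=> fh; apply: (fP i h Mh).
Qed.

Definition strict_wo (T : Type) (lt : rel T) :=
  [/\ irreflexive lt, transitive lt,
      forall x y, [\/ lt x y, x = y | lt y x] &
      forall P : set T, P !=set0 ->
        exists2 x, P x & forall y, P y -> ~~ lt y x].

(** The well-ordering principle gives a reflexive relation [R]; the strict order is the negation of
    its converse. *)
Lemma strict_wo_exists (T : Type) : exists lt : rel T, strict_wo lt.
Proof.
elim/Peq: T => T; have [R Rwo] := well_ordering_principle T.
have Rch : wo_chain R predT by move=> A _; apply: Rwo.
have Rtot x y : R x y || R y x by apply: (wo_chainW Rch).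
have Ranti x y : R x y -> R y x -> x = y.
  by move=> xy yx; apply: (wo_chain_antisymmetric Rch) => //; rewrite xy.
have Rmin (P : set T) : P !=set0 -> exists2 x, P x & forall y, P y -> R x y.
  move=> [x Px]; have [|z [[zP lb] _]] := Rwo (fun x => `[< P x >]).
    by exists x; apply/asboolP.
  by exists z => [|y Py]; [apply/asboolP|apply: lb; apply/asboolP].
(* Transitivity is read off the least element of [{x, y, z}]: if it is [x] the claim is immediate,
   otherwise antisymmetry identifies two of the three points. *)
have Rtrans y x z : R x y -> R y z -> R x z.
  move=> xy yz; have [|m mxyz lb] := Rmin [set x; y; z]; first by exists x;
    left; left.
  have [mx my mz] : [/\ R m x, R m y & R m z].
    by split; apply: lb; [left; left|left; right|right].
  case: mxyz => [[]|] em; rewrite -> em in *; first exact: mz.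
  - by rewrite (Ranti _ _ xy mx).
  - by rewrite -(Ranti _ _ yz my).
exists (fun x y => ~~ R y x); split.
- by move=> x; have := Rtot x x; rewrite orbb => ->.
- move=> y x z; have := Rtot x y => /orP[Rxy _|->//]; apply: contra => Rzx.
  exact: Rtrans Rzx Rxy.
- move=> x y; have [xy|_] := boolP (R x y); last by apply: Or33.
  have [yx|_] := boolP (R y x); last by apply: Or31.
  by apply: Or32; apply: Ranti.
- by move=> P /Rmin[x Px lb]; exists x => // y /lb; rewrite negbK.
Qed.

(** * Arithmetic of aleph_1 and passage to the next cardinal *)

Section Aleph1.
Variables (J : Type) (lt : rel J).
Hypotheses (wo : strict_wo lt) (ctbl : forall j, countable [set i | lt i j]).
Hypothesis J_min : forall S (Y : set S), ~ countable Y -> [set: J] #<= Y.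
Hypothesis J_unc : ~ countable [set: J].

(** If [A] were unbounded, the closed initial segments at its points would cover [J] by countably
    many countable sets. *)
Lemma countable_bounded (A : set J) : countable A ->
  exists j, forall i, A i -> lt i j.
Proof.
have [_ lt_trans tot _] := wo.
move=> cA; apply: contrapT => nb; apply: J_unc.
have -> : [set: J] = \bigcup_(i in A) ([set k | lt k i] `|` [set i]).
  apply/seteqP; split=> // k _; apply: contrapT => nk; apply: nb.
  exists k => i Ai; have [//|ik|ki] := tot i k; case: nk; exists i => //;
    [right|left] => //.
apply: bigcup_countable => // i _; rewrite -bigcup2E.
by apply: bigcup_countable => // -[|[|n]] _ //=; exact: countable1.
Qed.

(** Immediate successors: a singleton is countable, hence bounded, and well-foundedness picks the
    least element above it. *)
Let next j : {k | lt j k /\ forall i, lt j i -> ~~ lt i k}.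
Proof.
apply: cid; have [k kj] := countable_bounded (countable1 j).
have [_ _ _ wf] := wo; have [|m jm lb] := wf [set k | lt j k].
  by exists k; apply: kj.
by exists m.
Qed.
Let s j := sval (next j).
Let sP j : lt j (s j) /\ forall i, lt j i -> ~~ lt i (s j) := svalP (next j).

Let s_inj : injective s.
Proof.
have [_ _ tot _] := wo; move=> x y sxy.
have [xs xmin] := sP x; have [ys ymin] := sP y.
have [xy|//|yx] := tot x y.
- by have := xmin _ xy; rewrite sxy ys.
- by have := ymin _ yx; rewrite -sxy xs.
Qed.

(** The least element counts as a limit. *)
Let limit j := ~ exists i, s i = j.

(** A least counterexample is not a limit, so it is the successor of a smaller element, for which
    the claim holds. *)
Let limitE j : exists n l, limit l /\ iter n s l = j.
Proof.
apply: contrapT => nj.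
have [_ _ _ wf] := wo; have [|m nm lb] := wf [set j | ~ exists n l, limit l /\
  iter n s l = j].
  by exists j.
have [[i im]|lm] := pselect (exists i, s i = m); last by apply: nm; exists 0, m.
have im' : lt i m by rewrite -im; case: (sP i).
have /contrapT[n [l [ll e]]] : ~ ~ exists n l, limit l /\ iter n s l = i.
  by move=> ni; have := lb _ ni; rewrite im'.
by apply: nm; exists n.+1, l; rewrite /= e.
Qed.

(* Every j is the n-th successor of a unique limit, and there are aleph_1
   limits. *)
Lemma aleph1_muln : [set: J * nat] #<= [set: J].
Proof.
(* [J] is the union over [n] of the [n]-th successors of limits, so countably many limits would make
   it countable. *)
have Lunc : ~ countable [set j | limit j].
  move=> cL; apply: J_unc.
  have -> : [set: J] = \bigcup_n (iter n s @` [set j | limit j]).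
    apply/seteqP; split=> // j _; have [n [l [ll e]]] := limitE j.
    by exists n => //; exists l.
  by apply: bigcup_countable => // n _; apply: sub_countable cL;
    apply: card_image_le.
have /card_leP/injfunPex[f _ finj] := J_min Lunc.
have {}finj : exists2 f : J -> J, injective f & forall j, limit (f j).
  have /card_le_injP[g ginj] := J_min Lunc.
  exists (fun x => val (g (SigSub (mem_set (I : [set: J] x))))).
    by move=> x y /val_inj/ginj/(congr1 val).
  by move=> j; apply: (set_valP (g _)).
have {f} [f finj' flim] := finj.
apply/card_leT_injP; exists (fun p => iter p.2 s (f p.1)).
(* Successors are stripped from both sides in parallel; a limit is not a successor, so both sides
   run out together. *)
move=> [i n] [j m] /=; elim: n m => [|n IH] [|m] /=.
- by move=> /finj' ->.
- by move=> e; case: (flim i); exists (iter m s (f j)).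
- by move=> e; case: (flim j); exists (iter n s (f i)).
- by move=> /s_inj/IH[-> ->].
Qed.

(** Cardinality at most aleph_1, phrased as a cover by [J] many countable sets so that closure under
    [J]-indexed unions is direct. *)
Definition aleph1_small (T : Type) (S : set T) :=
  exists2 C : J -> set T, forall j, countable (C j) & S `<=` \bigcup_j C j.

(** The doubly indexed pieces [C i j] are regrouped by the larger index: stage [k] collects those
    with both indices at most [k], which are countably many. *)
Lemma aleph1_small_bigcup (T : Type) (S : J -> set T) :
  (forall j, aleph1_small (S j)) -> aleph1_small (\bigcup_j S j).
Proof.
have [_ _ tot _] := wo.
move=> smallS; have [C CP] : {C : J -> J -> set T & forall i,
    (forall j, countable (C i j)) /\ S i `<=` \bigcup_j C i j}.
  apply: (@choice _ _ (fun i (D : J -> set T) => (forall j, countable (D j)) /\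
    S i `<=` \bigcup_j D j)).
  by move=> i; have [D] := smallS i; exists D.
have cle k : countable [set i | lt i k \/ i = k].
  rewrite -/([set i | lt i k] `|` [set k]) -bigcup2E.
  by apply: bigcup_countable => // -[|[|n]] _ //=; exact: countable1.
exists (fun k => \bigcup_(i in [set i | lt i k \/ i = k])
                 \bigcup_(j in [set j | lt j k \/ j = k]) C i j).
  by move=> k; do 2! (apply: bigcup_countable => // ? _); exact: (CP _).1.
move=> x [i _ /(CP i).2[j _ Cx]]; have [ij|ij|ji] := tot i j.
- by exists j => //; exists i; [left|exists j => //; right].
- by exists j => //; exists i; [right|exists j => //; right].
- by exists i => //; exists i; [right|exists j => //; left].
Qed.

(** A point is coded by a countable piece that contains it and its number in that piece;
    [aleph1_muln] absorbs the factor [nat]. *)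
Lemma aleph1_small_card (T : Type) (S : set T) :
  aleph1_small S -> S #<= [set: J].
Proof.
move=> [C cC SC]; apply: card_le_trans aleph1_muln.
have [g gP] : {g : J -> T -> nat & forall j, {in C j &, injective (g j)}}.
  apply: (@choice _ _ (fun j (h : T -> nat) => {in C j &, injective h})) => j.
  exact/countable_injP.
have [h hP] : {h : S -> J & forall x, C (h x) (val x)}.
  apply: (@choice _ _ (fun (x : S) j => C j (val x))) => x.
  by have [j _ Cj] := SC _ (set_valP x); exists j.
apply: (card_le_trans (card_le_setT S)); apply/card_leT_injP.
exists (fun x => (h x, g (h x) (val x))) => x y [e].
have := hP y; rewrite -e => Cy ge; apply: val_inj; apply: gP ge;
  apply: mem_set => //; exact: hP.
Qed.

(* The order is that of the elements with a small initial segment: these form a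
   non-small set, while a J-indexed union of small sets is small. *)
Lemma aleph2_directed (W : Type) : ~ ([set: W] #<= [set: J]) ->
  exists (I : Type) (lt2 : rel I),
    [/\ inhabited I, irreflexive lt2, transitive lt2,
        forall u : J -> I, exists w, forall j, lt2 (u j) w &
        [set: I] #<= [set: W]].
Proof.
move=> nWJ; have [ltw [irr trans tot wf]] := strict_wo_exists W.
pose I := [set w | aleph1_small [set v | ltw v w]].
(* If [I] is small, a least point outside [I] has its initial segment inside [I], hence small, and
   so belongs to [I]. Thus [I] is all of [W], which is too large. *)
have nI : ~ aleph1_small I.
  move=> sI; apply: nWJ; apply: aleph1_small_card.
  suff -> : [set: W] = I by [].
  apply/seteqP; split=> // w _; apply: contrapT => nw.
  have [|m nm lb] := wf (~` I); first by exists w.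
  apply: nm; case: sI => C cC IC; exists C => // v vm; apply: IC.
  by apply: contrapT => /lb; rewrite vm.
exists I, (fun v w => ltw (val v) (val w)); split; last 1 first.
- by apply/card_leT_injP; exists val; exact: val_inj.
- apply: contrapT => ninh; apply: nI; exists (fun=> set0) => // w Iw.
  by case: ninh; split; exact: SigSub (mem_set Iw).
- by move=> x; rewrite irr.
- by move=> y x z; apply: trans.
(* If [u] is unbounded, every point of [I] lies at or below some [u j], so [I] is covered by [J]
   many small sets. *)
- move=> u; apply: contrapT => nb; apply: nI.
  suff IS : I `<=` \bigcup_j ([set v | ltw v (val (u j))] `|` [set val (u j)]).
    have [|C cC SC] := @aleph1_small_bigcup W
      (fun j => [set v | ltw v (val (u j))] `|` [set val (u j)]); last first.
      by exists C => // x /IS/SC.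
    move=> j; have [C cC SC] := set_valP (u j).
    exists (fun i => C i `|` [set val (u j)]).
      move=> i; rewrite -bigcup2E.
      by apply: bigcup_countable => // -[|[|n]] _ //=; exact: countable1.
    by move=> w [/SC[i _ Ci]|->]; [exists i => //; left|exists j => //; right].
  move=> w Iw; apply: contrapT => nw; apply: nb;
    exists (SigSub (mem_set Iw)) => j /=.
  have [//|e|wu] := tot (val (u j)) w; case: nw; exists j => //;
    [right|left] => //.
Qed.

End Aleph1.

(** Well-order [X] and keep the points with countable initial segments. Were these countably many,
    the least remaining point would have a countable initial segment too. *)
Lemma aleph1_order (T : Type) (X : set T) : ~ countable X ->
  exists (J : Type) (lt : rel J),
    [/\ strict_wo lt, forall j, countable [set i | lt i j],
        ~ countable [set: J] & [set: J] #<= X].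
Proof.
move=> Xunc; have [lt [irr trans tot wf]] := strict_wo_exists X.
pose J := [set x | countable [set y | lt y x]].
have Junc : ~ countable J.
  move=> cJ; apply: Xunc; apply: (card_le_trans (card_le_setT X)).
  suff -> : [set: X] = J by [].
  apply/seteqP; split=> // w _; apply: contrapT => nw.
  have [|m nm lb] := wf (~` J); first by exists w.
  apply: nm; apply: sub_countable cJ; apply: subset_card_le => v vm.
  by apply: contrapT => /lb; rewrite vm.
exists J, (fun x y => lt (val x) (val y)); split.
- split.
  + by move=> x; rewrite irr.
  + by move=> y x z; apply: trans.
  + by move=> x y; have [|/val_inj|] := tot (val x) (val y);
    [apply: Or31|apply: Or32|apply: Or33].
  + move=> P [x Px]; have [|_ [y Py <-] lb] := wf [set val x | x in P].
      by exists (val x); exists x.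
    by exists y => // z Pz; apply: lb; exists z.
- move=> j; have /countable_injP[f finj] := set_valP j.
  apply/countable_injP; exists (f \o val) => x y; rewrite !inE => xj yj.
  by move=> /finj e; apply/val_inj/e; rewrite inE.
- by move=> cJ; apply: Junc; apply: sub_countable cJ; apply: card_le_setT.
- apply/card_le_injP; exists (fun x => val (val x)) => x y.
  by move=> /val_inj/val_inj.
Qed.

Definition countably_directed (J : Type) (lt : rel J) :=
  [/\ irreflexive lt, transitive lt &
      forall u : nat -> J, exists j, forall n, lt (u n) j].

Lemma index_orders : aleph1_lt_continuum ->
  exists (J1 J2 : Type) (lt1 : rel J1) (lt2 : rel J2),
    [/\ inhabited J1, inhabited J2, countably_directed lt1 &
        countably_directed lt2] /\
    [/\ forall u : J1 -> J2, exists j, forall i, lt2 (u i) j,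
        [set: J1] #<= [set: set nat] & [set: J2] #<= [set: set nat]].
Proof.
move=> [T [X [[Xunc Xmin] [XleC CnleX]]]].
have [J1 [lt1 [wo ctbl unc J1X]]] := aleph1_order Xunc.
have J1min S (Y : set S) : ~ countable Y -> [set: J1] #<= Y.
  by move=> /Xmin; exact: card_le_trans.
(* The failure of CH enters here: the continuum does not embed into [J1], so [aleph2_directed]
   applies to [set nat]. *)
have nC : ~ ([set: set nat] #<= [set: J1]).
  by move=> C1; apply: CnleX; exact: card_le_trans C1 J1X.
have [I [lt2 [inh2 irr2 trans2 bd2 IW]]] :=
  aleph2_directed wo ctbl J1min unc nC.
have [irr1 trans1 _ _] := wo.
have bd1 (u : nat -> J1) : exists j, forall n, lt1 (u n) j.
  have [|j uj] := countable_bounded wo ctbl unc (_ : countable (range u)).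
    by exact: card_image_le.
  by exists j => n; apply: uj; exists n.
have inh1 : inhabited J1.
  by apply: contrapT => n1; apply: unc; rewrite (_ : [set: J1] = set0) //;
    apply/seteqP; split=> // x _; case: n1; split.
exists J1, I, lt1, lt2; split; split=> //; last exact: card_le_trans J1X XleC.
split=> // u.
have J1nat : [set: nat] #<= [set: J1].
  by apply/infiniteP => /finite_set_countable.
have [e einj] := (card_leT_injP _ _).1 J1nat.
(* A sequence is extended along an injection of [nat] into [J1] to a [J1]-indexed family, which has
   a bound; [u 0] fills the indices off the range. *)
have [w wP] := bd2 (fun j => if pselect (exists n,
  e n = j) is left h then u (sval (cid h)) else u 0%N).
exists w => n; have := wP (e n); case: pselect => [h|[]]; last by exists n.
by case: (cid h) => m /= /einj->.
Qed.

Local Open Scope quotient_scope.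
Local Open Scope complex_scope.
Local Open Scope ring_scope.

(** * The algebra of step functions *)

Section Cabs.
Variable R : realType.
Implicit Types z w : R[i].

Definition cabs z : R := complex.Re `|z|.

Lemma cabsE z : `|z| = (cabs z)%:C.
Proof. exact: normc_real. Qed.

Lemma cabs_ge0 z : 0 <= cabs z.
Proof. by rewrite -lecR -cabsE normr_ge0. Qed.

Lemma cabs0 : cabs 0 = 0.
Proof. by rewrite /cabs normr0. Qed.

Lemma cabs_eq0 z : cabs z = 0 -> z = 0.
Proof. by move=> z0; apply/normr0_eq0; rewrite cabsE z0. Qed.

Lemma cabsN z : cabs (- z) = cabs z.
Proof. by rewrite /cabs normrN. Qed.

Lemma cabsB z w : cabs (z - w) = cabs (w - z).
Proof. by rewrite -cabsN opprB. Qed.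

Lemma cabsD z w : cabs (z + w) <= cabs z + cabs w.
Proof. by rewrite -lecR rmorphD /= -!cabsE ler_normD. Qed.

Lemma cabs_trans w z1 z2 : cabs (z1 - z2) <= cabs (z1 - w) + cabs (w - z2).
Proof. by rewrite (le_trans _ (cabsD _ _))// addrA subrK. Qed.

Lemma cabsM z w : cabs (z * w) = cabs z * cabs w.
Proof. by apply: (@complexI R); rewrite rmorphM /= -!cabsE normrM. Qed.

Lemma cabs_conj z : cabs z^* = cabs z.
Proof. by rewrite /cabs norm_conjC. Qed.

Lemma cabs_real (x : R) : cabs x%:C = `|x|.
Proof. by rewrite /cabs /= expr0n addr0 sqrtr_sqr. Qed.

Lemma cabs_ReIm z : cabs z <= `|complex.Re z| + `|complex.Im z|.
Proof.
rewrite {1}[z]complexE (le_trans (cabsD _ _))// cabsM !cabs_real.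
suff -> : cabs 'i = 1 by rewrite mul1r.
by rewrite /cabs /= expr0n expr1n add0r sqrtr1.
Qed.

Lemma Re_le_cabs z : `|complex.Re z| <= cabs z.
Proof.
case: z => a b; rewrite /cabs /= -sqrtr_sqr ler_wsqrtr//.
by rewrite lerDl sqr_ge0.
Qed.

Lemma Im_le_cabs z : `|complex.Im z| <= cabs z.
Proof.
case: z => a b; rewrite /cabs /= -sqrtr_sqr ler_wsqrtr//.
by rewrite lerDr sqr_ge0.
Qed.

End Cabs.

Section StepFunctions.
Variables (R : realType) (J : Type) (lt : rel J).
Implicit Types (f g : J * nat ->
  R[i]) (s t : seq J) (k m : nat) (p q : J * nat).

Definition same_cell s k p q :=
  map (lt p.1) s = map (lt q.1) s /\ (p.2 = q.2 %[mod k])%N.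

(* The residue of the second coordinate is what makes cells splittable: passing
   from k to k * m cuts each cell into m nonempty pieces. *)
Definition step_on s k f :=
  [/\ (0 < k)%N, forall p q, same_cell s k p q -> f p = f q &
      forall p, ~~ has (lt p.1) s -> f p = 0].

Definition step f := exists s k, step_on s k f.

(** Concatenating the lists and multiplying the moduli yields a common refinement, which lets
    finitely many step functions share one partition. *)
Lemma same_cell_catl s t k m p q :
  same_cell (s ++ t) (k * m) p q -> same_cell s k p q.
Proof.
rewrite /same_cell !map_cat => -[st km]; split.
  by have /(congr1 (take (size s))) := st; rewrite !take_size_cat ?size_map.
by have /(congr1 (modn^~ k)) := km; rewrite !modn_dvdm ?dvdn_mulr.
Qed.

Lemma same_cell_catr s t k m p q :
  same_cell (s ++ t) (k * m) p q -> same_cell t m p q.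
Proof.
rewrite /same_cell !map_cat => -[st km]; split.
  by have /(congr1 (drop (size s))) := st; rewrite !drop_size_cat ?size_map.
by have /(congr1 (modn^~ m)) := km; rewrite !modn_dvdm ?dvdn_mull.
Qed.

Lemma step_onl s t k m f : (0 < m)%N -> step_on s k f ->
  step_on (s ++ t) (k * m) f.
Proof.
move=> m0 [k0 fs f0]; split; first by rewrite muln_gt0 k0.
  by move=> p q /same_cell_catl; exact: fs.
by move=> p; rewrite has_cat negb_or => /andP[/f0].
Qed.

Lemma step_onr s t k m f : (0 < k)%N -> step_on t m f ->
  step_on (s ++ t) (k * m) f.
Proof.
move=> k0 [m0 fs f0]; split; first by rewrite muln_gt0 k0.
  by move=> p q /same_cell_catr; exact: fs.
by move=> p; rewrite has_cat negb_or => /andP[_ /f0].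
Qed.

Lemma step2 f g : step f -> step g ->
  exists s k, step_on s k f /\ step_on s k g.
Proof.
move=> [s [k fs]] [t [m gt]]; have [k0 _ _] := fs; have [m0 _ _] := gt.
by exists (s ++ t), (k * m)%N; split; [apply: step_onl|apply: step_onr].
Qed.

Lemma step_tuple n (a : 'I_n -> J * nat -> R[i]) : (forall i, step (a i)) ->
  exists s k, (0 < k)%N /\ forall i, step_on s k (a i).
Proof.
elim: n a => [|n IH] a ha; first by exists [::], 1%N; split=> // -[].
have [s [k [k0 sk]]] := IH (fun i => a (lift ord0 i)) (fun i => ha _).
have [t [m tm]] := ha ord0; have [m0 _ _] := tm.
exists (t ++ s), (m * k)%N; split; first by rewrite muln_gt0 m0.
by move=> i; case: (unliftP ord0 i) => [j|] ->;
  [apply: step_onr|apply: step_onl].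
Qed.

(** A cell is determined by a tuple of booleans and a residue, hence there are finitely many, and
    one representative of each suffices. *)
Lemma finite_cells (T : Type) s k (h : J * nat -> T) : (0 < k)%N ->
  (forall p q, same_cell s k p q -> h p = h q) ->
  exists n (v : 'I_n -> J * nat), forall p, exists i, h p = h (v i).
Proof.
move=> k0 hs; have [[p0 _]|np] := pselect (exists p : J * nat, True);
  last first.
  by exists 0%N, (fun i : 'I_0 => False_rect _ (notF (ltn_ord i))) => p;
    case: np; exists p.
pose cell p : (size s).-tuple bool * 'I_k :=
  (map_tuple (lt p.1) (in_tuple s), Ordinal (ltn_pmod p.2 k0)).
have cellP p q : cell p = cell q -> same_cell s k p q.
  by move=> [e1 e2]; split => //; rewrite e1.
(* Codes of empty cells receive the arbitrary point [p0]. *)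
pose v c := if pselect (exists p,
  cell p = c) is left e then sval (cid e) else p0.
exists #|{: (size s).-tuple bool * 'I_k}|, (fun i => v (enum_val i)) => p.
exists (enum_rank (cell p)); rewrite enum_rankK; apply: hs; apply: cellP.
rewrite /v; case: pselect => [e|[]]; last by exists p.
by case: (cid e).
Qed.

Lemma step_bounded f : step f -> exists M : R, forall p, cabs (f p) <= M.
Proof.
move=> [s [k [k0 fs _]]]; have [n [v vP]] := finite_cells k0 fs.
exists (\sum_i cabs (f (v i))) => p; have [i ->] := vP p.
by rewrite (bigD1 i)//= lerDl sumr_ge0// => j _; apply: cabs_ge0.
Qed.

Lemma step_map2 (u : R[i] -> R[i] -> R[i]) f g : u 0 0 = 0 ->
  step f -> step g -> step (fun p => u (f p) (g p)).
Proof.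
move=> u0 fs gs; have [s [k [[k0 hf hf0] [_ hg hg0]]]] := step2 fs gs.
exists s, k; split=> // [p q pq|p ps]; first by rewrite (hf p q)// (hg p q).
by rewrite hf0// hg0.
Qed.

Lemma step0 : step (fun=> 0).
Proof. by exists [::], 1%N; split. Qed.

Definition step_closure : {pred J * nat -> R[i]} :=
  [pred f | `[< forall e : R, 0 < e ->
     exists2 g, step g & forall p, cabs (f p - g p) <= e >]].

Lemma step_closureP f :
  reflect (forall e : R, 0 < e ->
      exists2 g, step g & forall p, cabs (f p - g p) <= e)
    (f \in step_closure).
Proof. exact: asboolP. Qed.

Lemma step_closure_bounded f : f \in step_closure ->
  exists2 M : R, 0 <= M & forall p, cabs (f p) <= M.
Proof.
move=> /step_closureP/(_ 1 ltr01)[g /step_bounded[M gM] fg].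
exists (1 + `|M|) => [|p]; first by rewrite addr_ge0.
rewrite -[f p](subrK (g p)) (le_trans (cabsD _ _))// lerD//.
by rewrite (le_trans (gM p))// ler_norm.
Qed.

Lemma step_closure_step f : step f -> f \in step_closure.
Proof.
move=> fs; apply/step_closureP => e e0; exists f => // p.
by rewrite subrr cabs0 ltW.
Qed.

(** This puts the limit of a Cauchy filter back into the algebra. Half of the error goes to each
    approximation. *)
Lemma step_closure_lim f : (forall e : R, 0 < e ->
    exists2 g, g \in step_closure & forall p, cabs (f p - g p) <= e) ->
  f \in step_closure.
Proof.
move=> hf; apply/step_closureP => e e0;
  have e20 : 0 < e / 2 by rewrite divr_gt0.
have [g /step_closureP/(_ _ e20)[h hs gh] fg] := hf _ e20.
by exists h => // p;
  rewrite (le_trans (cabs_trans (g p) _ _))// [leRHS]splitr lerD.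
Qed.

Lemma step_closure_mul f g : f \in step_closure -> g \in step_closure ->
  (fun p => f p * g p) \in step_closure.
Proof.
move=> fc gc; have [M M0 fM] := step_closure_bounded fc.
have [N N0 gN] := step_closure_bounded gc.
apply/step_closureP => e e0.
(* The error of the product is at most [M * d + d * N + d * d], and [d <= 1] reduces the last term
   to [d]. *)
pose d := Num.min 1 (e / (M + N + 1)).
have K0 : 0 < M + N + 1 by rewrite ltr_wpDl// addr_ge0.
have d0 : 0 < d by rewrite lt_min ltr01 divr_gt0.
move/step_closureP: fc => /(_ _ d0)[f' f's ff'].
move/step_closureP: gc => /(_ _ d0)[g' g's gg'].
exists (fun p => f' p * g' p); first by apply: step_map2 => //; rewrite mul0r.
move=> p.
have -> : f p * g p - f' p * g' p =
    f p * (g p - g' p) + (f p - f' p) * g p - (f p - f' p) * (g p - g' p).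
  by rewrite !mulrBl !mulrBr; ring.
rewrite (le_trans (cabsD _ _))// cabsN (le_trans (lerD (cabsD _ _) (lexx _)))//
  !cabsM.
have d1 : d <= 1 by rewrite ge_min lexx.
have de : d * (M + N + 1) <= e by rewrite -ler_pdivlMr// ge_min lexx orbT.
rewrite (le_trans _ de)// !mulrDr mulr1 (mulrC d M).
rewrite !lerD//; [apply: ler_pM|apply: ler_pM|]; rewrite ?cabs_ge0//.
by rewrite -[leRHS]mulr1 ler_pM ?cabs_ge0// (le_trans (gg' p)).
Qed.

Lemma step_closure_conj f :
  f \in step_closure -> (fun p => (f p)^*) \in step_closure.
Proof.
move=> /step_closureP fc; apply/step_closureP => e /fc[g gs fg].
exists (fun p => (g p)^*); first by apply: (@step_map2 (fun x _ => x^*) g g) => //;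
  rewrite rmorph0.
by move=> p; rewrite -rmorphB cabs_conj.
Qed.

Lemma step_closure_submod : submod_closed step_closure.
Proof.
split; first by apply: step_closure_step; exact: step0.
move=> c f g fc gc; apply/step_closureP => e e0.
have K0 : 0 < cabs c + 1 by rewrite ltr_wpDl ?cabs_ge0.
have d0 : 0 < e / (cabs c + 1) by rewrite divr_gt0.
move/step_closureP: fc => /(_ _ d0)[f' f's ff'].
move/step_closureP: gc => /(_ _ d0)[g' g's gg'].
exists (fun p => c * f' p + g' p).
  by apply: (@step_map2 (fun x y => c * x + y)) => //; rewrite mulr0 addr0.
move=> p; rewrite [X in cabs (X - _)]/(c * f p + g p) opprD addrACA -mulrBr.
rewrite (le_trans (cabsD _ _))// cabsM.
have -> : e = cabs c * (e / (cabs c + 1)) + e / (cabs c + 1).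
  by rewrite -[X in _ + X]mul1r -mulrDl mulrC divfK ?gt_eqF.
by rewrite lerD// ler_wpM2l ?cabs_ge0.
Qed.

HB.instance Definition _ :=
  GRing.isSubmodClosed.Build R[i] (J * nat -> R[i])
    step_closure step_closure_submod.

Record stepalg := Stepalg {
  stepval :> J * nat -> R[i];
  _ : stepval \in step_closure }.

HB.instance Definition _ := [isSub for stepval].
HB.instance Definition _ := [Choice of stepalg by <:].
HB.instance Definition _ := [SubChoice_isSubLmodule of stepalg by <:].

Implicit Types a b c : stepalg.

Lemma stepalg_eq a b : (forall p, a p = b p) -> a = b.
Proof. by move=> ab; apply/val_inj/funext. Qed.

Definition stepalg_mul a b := Stepalg (step_closure_mul (valP a) (valP b)).
Definition stepalg_star a := Stepalg (step_closure_conj (valP a)).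

Fact stepalg_mulA : associative stepalg_mul.
Proof. by move=> a b c; apply: stepalg_eq => p /=; rewrite mulrA. Qed.
Fact stepalg_mulDl : left_distributive stepalg_mul +%R.
Proof. by move=> a b c; apply: stepalg_eq => p /=; rewrite mulrDl. Qed.
Fact stepalg_mulDr : right_distributive stepalg_mul +%R.
Proof. by move=> a b c; apply: stepalg_eq => p /=; rewrite mulrDr. Qed.
Fact stepalg_mulZl (x : R[i]) a b :
  stepalg_mul (x *: a) b = x *: stepalg_mul a b.
Proof. by apply: stepalg_eq => p; exact/esym/mulrA. Qed.
Fact stepalg_mulZr (x : R[i]) a b :
  stepalg_mul a (x *: b) = x *: stepalg_mul a b.
Proof. by apply: stepalg_eq => p; exact: mulrCA. Qed.
Fact stepalg_starK : involutive stepalg_star.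
Proof. by move=> a; apply: stepalg_eq => p /=; rewrite conjCK. Qed.
Fact stepalg_starD : {morph stepalg_star : a b / a + b}.
Proof. by move=> a b; apply: stepalg_eq => p /=; rewrite rmorphD. Qed.
Fact stepalg_starZ (x : R[i]) a : stepalg_star (x *: a) = x^* *: stepalg_star a.
Proof. by apply: stepalg_eq => p /=; rewrite rmorphM. Qed.
Fact stepalg_starM a b :
  stepalg_star (stepalg_mul a b) =
  stepalg_mul (stepalg_star b) (stepalg_star a).
Proof. by apply: stepalg_eq => p /=; rewrite rmorphM mulrC. Qed.

HB.instance Definition _ := Lmodule_isStarAlgebra.Build R stepalg
  stepalg_mulA stepalg_mulDl stepalg_mulDr stepalg_mulZl stepalg_mulZr
  stepalg_starK stepalg_starD stepalg_starZ stepalg_starM.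

(** For empty [J] this is the supremum of the empty set, which is 0 by convention; hence the
    hypothesis [0 <= M] in [snorm_le]. *)
Definition snorm a : R := sup [set cabs (a p) | p in setT].

Lemma snorm_le a (M : R) :
  0 <= M -> (forall p, cabs (a p) <= M) -> snorm a <= M.
Proof.
move=> M0 aM; rewrite /snorm; set S := (X in sup X).
have [->|/set0P S0] := eqVneq S set0; first by rewrite sup0.
by apply: ge_sup => // _ [p _ <-].
Qed.

Lemma le_snorm a p : cabs (a p) <= snorm a.
Proof.
apply: ub_le_sup; last by exists p.
by have [M _ aM] := step_closure_bounded (valP a); exists M => _ [q _ <-].
Qed.

Lemma snorm_ge0 a : 0 <= snorm a.
Proof.
rewrite /snorm; set S := (X in sup X).
have [->|/set0P[_ [p _ _]]] := eqVneq S set0; first by rewrite sup0.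
by rewrite (le_trans (cabs_ge0 (a p)))// le_snorm.
Qed.

Let snormC a : R[i] := (snorm a)%:C.

Fact snormD a b : snormC (a + b) <= snormC a + snormC b.
Proof.
rewrite -rmorphD /= lecR; apply: snorm_le => [|p];
  first by rewrite addr_ge0 ?snorm_ge0.
by rewrite (le_trans (cabsD _ _))// lerD ?le_snorm.
Qed.

Fact snormZ (x : R[i]) a : snormC (x *: a) = `|x| * snormC a.
Proof.
rewrite cabsE -rmorphM; congr (_%:C); apply/eqP; rewrite eq_le; apply/andP;
  split.
  apply: snorm_le => [|p]; first by rewrite mulr_ge0 ?cabs_ge0 ?snorm_ge0.
  by rewrite cabsM ler_wpM2l ?cabs_ge0 ?le_snorm.
have [->|x0] := eqVneq (cabs x) 0; first by rewrite mul0r snorm_ge0.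
have {}x0 : 0 < cabs x by rewrite lt_def x0 cabs_ge0.
rewrite mulrC -ler_pdivlMr//; apply: snorm_le => [|p].
  by rewrite divr_ge0 ?snorm_ge0 ?cabs_ge0.
by rewrite ler_pdivlMr// mulrC -cabsM; exact: (le_snorm (x *: a) p).
Qed.

Fact snorm_eq0 a : snormC a = 0 -> a = 0.
Proof.
move=> /(@complexI R)/= a0; apply: stepalg_eq => p; apply: cabs_eq0.
by apply/eqP; rewrite eq_le cabs_ge0 andbT -a0 le_snorm.
Qed.

HB.instance Definition _ :=
  Lmodule_isNormed.Build R[i] stepalg snormD snormZ snorm_eq0.

Lemma stepalg_normE a : `|a| = (snorm a)%:C.
Proof. by []. Qed.

End StepFunctions.

(** * Completeness and the C*-identity *)

Section StepCompletion.
Variables (R : realType) (J : Type) (lt : rel J).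
Notation A := (stepalg R lt).
Implicit Types a b c : A.

Lemma stepalg_ballE a (e : R) : ball a e%:C = [set b | snorm (a - b) < e].
Proof.
by apply/funext => b; rewrite -ball_normE /ball_/= stepalg_normE ltcR.
Qed.

Let cauchy_small (F : set_system A) : ProperFilter F -> cauchy F ->
  forall e : R, 0 < e -> exists a, F [set b | snorm (a - b) < e].
Proof.
move=> FF Fc e e0; have /cauchyP/(_ e%:C) := Fc.
by rewrite ltcR => /(_ e0)[a]; rewrite stepalg_ballE; exists a.
Qed.

(** The error [e] does not depend on [u]. Applied to all coordinates, this makes the pointwise
    limits uniform. *)
Let coord_lim (F : set_system A) (u : A -> R) : ProperFilter F -> cauchy F ->
  (forall a b, `|u a - u b| <= snorm (a - b)) ->
  exists l : R, forall a e, F [set b | snorm (a - b) < e] -> `|u a - l| <= e.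
Proof.
move=> FF Fc uL.
have Fex := cauchy_small FF Fc.
have uc : cvg (u @ F).
  apply: (@R_complete R); apply/cauchyP => e e0; have [a Fa] := Fex _ e0.
  exists (u a); apply: (@filterS A F _ [set b | snorm (a - b) < e] [set b |
    ball (u a) e (u b)] _ Fa) => b /= ab.
  rewrite -ball_normE /ball_ /=.
  exact: le_lt_trans (uL a b) ab.
have /cvg_ex[l /cvgrPdist_lt ul] := uc; exists l => a e Fa;
  apply/ler_addgt0Pr => h h0.
have [b [/= ab bl]] := filter_ex (filterI Fa (ul h h0)).
rewrite (le_trans (ler_distD (u b) _ _))// lerD//;
  first by rewrite (le_trans (uL _ _)) ?ltW.
by rewrite distrC ltW.
Qed.

Lemma stepalg_complete (F : set_system A) : ProperFilter F -> cauchy F -> cvg F.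
Proof.
move=> FF Fc.
have diff a b p : cabs (a p - b p) <=
  snorm (a - b) by exact: (le_snorm (a - b) p).
have [re reP] := choice (fun p => @coord_lim F (fun a => complex.Re (a p)) FF Fc
  (fun a b => le_trans (eq_ind _ (fun x => `|x| <=
    _) (Re_le_cabs (a p - b p)) _ (raddfB (@complex.Re R) _ _)) (diff a b p))).
have [im imP] := choice (fun p => @coord_lim F (fun a => complex.Im (a p)) FF Fc
  (fun a b => le_trans (eq_ind _ (fun x => `|x| <=
    _) (Im_le_cabs (a p - b p)) _ (raddfB (@complex.Im R) _ _)) (diff a b p))).
pose f p : R[i] := re p +i* im p.
(* Real and imaginary parts each contribute an error [e]. *)
have fP a e p : F [set b | snorm (a - b) < e] -> cabs (a p - f p) <= 2 * e.
  move=> Fa; rewrite (le_trans (cabs_ReIm _))// mulr2n mulrDl mul1r.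
  by rewrite !raddfB /= lerD ?reP ?imP.
have Fex := cauchy_small FF Fc.
have fc : f \in @step_closure R J lt.
  apply: step_closure_lim => e e0; have [a Fa] :=
    Fex _ (divr_gt0 e0 (ltr0Sn _ 1)).
  exists a; first exact: valP.
  by move=> p; rewrite cabsB (le_trans (fP _ _ _ Fa))// mulrC divfK.
apply/cvg_ex; exists (Stepalg fc); apply/cvg_ballP => e e0.
(* A positive element of [R[i]] is real, so the radius may be taken in [R]. *)
have {}e0 : 0 < complex.Re e /\ e = (complex.Re e)%:C by case: e e0 => x y;
  rewrite ltcE => /andP[/eqP/= -> ].
have [d0 ->] := e0; set d := complex.Re e in d0 *.
have d40 : 0 < d / 4 by rewrite divr_gt0.
have [a Fa] := Fex _ d40; rewrite stepalg_ballE.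
apply: (@filterS A F _ [set b | snorm (a - b) < d / 4] _ _ Fa) => b /= ab.
have -> : Stepalg fc - b = (Stepalg fc - a) + (a - b) by rewrite addrA subrK.
apply: le_lt_trans (_ : 2 * (d / 4) + d / 4 < d); last by lra.
have snD (x y : A) : snorm (x + y) <=
  snorm x + snorm y by rewrite -lecR rmorphD -!stepalg_normE ler_normD.
rewrite (le_trans (snD _ _))// lerD//; last exact: ltW.
apply: snorm_le => [|p]; first by rewrite mulr_ge0// ltW.
by rewrite cabsB; exact: fP.
Qed.

HB.instance Definition _ := Uniform_isComplete.Build A stepalg_complete.

Fact stepalg_normM a b : `|a ** b| <= `|a| * `|b|.
Proof.
rewrite !stepalg_normE -rmorphM lecR; apply: snorm_le => [|p].
  by rewrite mulr_ge0 ?snorm_ge0.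
by rewrite cabsM ler_pM ?cabs_ge0 ?le_snorm.
Qed.

Fact stepalg_cstar a : `|star a ** a| = `|a| ^+ 2.
Proof.
rewrite !stepalg_normE -rmorphXn; congr (_%:C); apply/eqP; rewrite eq_le;
  apply/andP; split.
  apply: snorm_le => [|p]; first by rewrite sqr_ge0.
  by rewrite cabsM cabs_conj expr2 ler_pM ?cabs_ge0 ?le_snorm.
(* For the converse, square roots are compared: [cabs (a p)] is the root of the modulus of
   [star a ** a] at [p]. *)
rewrite -[leRHS]sqr_sqrtr ?snorm_ge0// ler_sqr ?nnegrE ?snorm_ge0 ?sqrtr_ge0//.
apply: snorm_le => [|p]; first exact: sqrtr_ge0.
rewrite -(ger0_norm (cabs_ge0 _)) -sqrtr_sqr ler_wsqrtr//.
have := le_snorm (star a ** a) p; congr (_ <= _).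
by rewrite cabsM cabs_conj expr2.
Qed.

HB.instance Definition _ := StarAlgebra_isCstarAlgebra.Build R A
  stepalg_normM stepalg_cstar.

End StepCompletion.
(** * Uniform continuity of formulas *)

Section SupInf.
Variables (R : realType) (T1 T2 : Type) (D1 : set T1) (D2 : set T2).
Variables (h1 : T1 -> R) (h2 : T2 -> R) (e : R).

(** The two domains may differ: the lemma serves both for moduli of continuity within one algebra
    and for comparing two algebras. *)
Lemma sup_le_approx : D1 !=set0 -> has_ubound (h2 @` D2) ->
  (forall x, D1 x -> exists2 y, D2 y & h1 x <= h2 y + e) ->
  sup (h1 @` D1) <= sup (h2 @` D2) + e.
Proof.
move=> [x0 D0] ub h12; apply: ge_sup; first by exists (h1 x0), x0.
move=> _ [x /h12[y Dy xy] <-]; rewrite (le_trans xy)// lerD2r.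
by apply: ub_le_sup => //; exists y.
Qed.

Lemma inf_le_approx : D1 !=set0 -> has_lbound (h2 @` D2) ->
  (forall x, D1 x -> exists2 y, D2 y & h2 y <= h1 x + e) ->
  inf (h2 @` D2) <= inf (h1 @` D1) + e.
Proof.
move=> [x0 D0] lb h12; rewrite -lerBlDr; apply: lb_le_inf;
  first by exists (h1 x0), x0.
move=> _ [x /h12[y Dy xy] <-]; rewrite lerBlDr (le_trans _ xy)//.
by apply: ge_inf => //; exists y.
Qed.

End SupInf.

Section UniformContinuity.
Variable R : realType.

(** The box is compact. Only [x] has to lie in it: the covering argument controls a full ball around
    each of its points, so [y] may lie outside. *)
Lemma continuous_box_bounded_unif k (u : 'rV[R]_k -> R) (M : R) :
  continuous u ->
  (exists B : R, forall x : 'rV[R]_k,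
    (forall i, `|x ord0 i| <= M) -> `|u x| <= B) /\
  (forall e : R, 0 < e -> exists2 d : R, 0 < d & forall x y : 'rV[R]_k,
    (forall i, `|x ord0 i| <= M) -> (forall i, `|x ord0 i - y ord0 i| < d) ->
    `|u x - u y| <= e).
Proof.
move=> cu; pose K : set 'rV[R]_k := [set v | forall i, v ord0 i \in `[- M, M]].
have cK : compact K.
  by apply: (@rV_compact R k (fun=> `[- M, M]%classic)) => i;
    exact: segment_compact.
have KP (x : 'rV[R]_k) : (forall i, `|x ord0 i| <= M) -> K x.
  by move=> xM i; rewrite in_itv /= -ler_norml.
split.
  have /compact_bounded[B [_ BP]] : compact (u @` K).
    by apply: continuous_compact => //; apply: continuous_subspaceT.
  exists (B + 1) => x /KP Kx; apply: (BP (B + 1)); first by rewrite ltrDl.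
  by exists x.
move=> e e0; have /compact_near_coveringP cK' := cK.
have e20 : 0 < e / 2 by rewrite divr_gt0.
have := cK' R (0^'+) (fun d x => forall y, ball x d y -> `|u x - u y| <= e) _.
case.
  move=> x _; have /cvgrPdist_le/(_ _ e20)/nbhs_ballP[d /= d0 xd] := cu x.
  have d20 : 0 < d / 2 by rewrite divr_gt0.
  near=> x' d'.
  have xx' : ball x (d / 2) x' by near: x'; exact: nbhsx_ballx.
  have d'd : d' <= d / 2 by near: d'; exact: nbhs_right_le.
  move=> y x'y; have xy : ball x d y.
    by apply: ball_split xx' _; apply: le_ball x'y.
  have xx'' : ball x d x' by apply: le_ball xx';
    rewrite ler_pdivrMr// ler_pMr// ler1n.
  rewrite (le_trans (ler_distD (u x) _ _))// [leRHS]splitr lerD//;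
    last exact: xd.
  by rewrite distrC; exact: xd.
move=> d /= d0 dP; exists (d / 2); first by rewrite divr_gt0.
move=> x y /KP Kx xy; apply: (dP (d / 2)) => //=.
- by rewrite sub0r normrN ger0_norm ?divr_ge0 ?ltW// ltr_pdivrMr// ltr_pMr//
  ltr1n.
- by rewrite divr_gt0.
- split=> [|i j]; first by rewrite divr_gt0.
  by rewrite -ball_normE /ball_ /= (ord1 i).
Unshelve. all: by end_near. Qed.

Variable A : cstarAlgType R.

Definition in_ball n (r : R) (e : 'I_n -> A) := forall i, cnorm (e i) <= r.

(** Boundedness is carried along because a continuous connective is uniformly continuous only near a
    compact box and [sup] is meaningful only on bounded sets. *)
Definition bounded_unif n (r : R) (phi : ('I_n -> A) -> R) :=
  (exists M : R, forall e, in_ball r e -> `|phi e| <= M) /\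
  (forall h : R, 0 < h -> exists2 d : R, 0 < d & forall e e',
    in_ball r e -> in_ball r e' -> (forall i, cnorm (e i - e' i) <= d) ->
    `|phi e - phi e'| <= h).

Lemma eval_term_bounded n (t : term R n) (r : R) :
  exists2 M : R, 0 <= M &
    forall e, in_ball r e -> cnorm (eval_term (A := A) e t) <= M.
Proof.
elim: t => [i||s [M M0 sM] t [N N0 tN]|c t [N N0 tN]|s [M M0 sM] t [N N0 tN]|t
  [N N0 tN]] /=.
- exists `|r| => // e er; exact: le_trans (er i) (ler_norm r).
- by exists 0 => // e _; rewrite cnorm0.
- exists (M + N) => [|e er]; first exact: addr_ge0.
  by rewrite (le_trans (cnormD _ _))// lerD ?sM ?tN.
- have c0 : 0 <= complex.Re `|c| by rewrite -lecR -normc_real normr_ge0.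
  exists (complex.Re `|c| * N) => [|e er]; first exact: mulr_ge0.
  by rewrite cnormZ ler_wpM2l ?tN.
- exists (M * N) => [|e er]; first exact: mulr_ge0.
  by rewrite (le_trans (cnormM _ _))// ler_pM ?cnorm_ge0 ?sM ?tN.
- by exists N => // e er; rewrite cnorm_star tN.
Qed.

Lemma eval_term_lipschitz n (t : term R n) (r : R) :
  exists2 K : R, 0 <= K & forall e e' (d : R),
    in_ball r e -> in_ball r e' -> 0 <= d ->
    (forall i, cnorm (e i - e' i) <= d) ->
    cnorm (eval_term (A := A) e t - eval_term e' t) <= K * d.
Proof.
elim: t => [i||s [M M0 sM] t [N N0 tN]|c t [N N0 tN]|s [M M0 sM] t [N N0 tN]|t
  [N N0 tN]] /=.
- by exists 1 => // e e' d _ _ _ ed; rewrite mul1r.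
- by exists 0 => // e e' d _ _ _ _; rewrite subrr cnorm0 mul0r.
- exists (M + N) => [|e e' d er e'r d0 ed]; first exact: addr_ge0.
  by rewrite opprD addrACA (le_trans (cnormD _ _))// mulrDl lerD ?sM ?tN.
- have c0 : 0 <= complex.Re `|c| by rewrite -lecR -normc_real normr_ge0.
  exists (complex.Re `|c| * N) => [|e e' d er e'r d0 ed]; first exact: mulr_ge0.
  by rewrite -scalerBr cnormZ -mulrA ler_wpM2l ?tN.
- have [B B0 sB] := eval_term_bounded s r; have [C C0 tC] :=
  eval_term_bounded t r.
  (* [B] and [C] bound the factors, [M] and [N] are their Lipschitz constants; the difference of
     products is split as [x ** (y - y') + (x - x') ** y']. *)
  exists (B * N + M * C) => [|e e' d er e'r d0 ed];
    first by rewrite addr_ge0 ?mulr_ge0.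
  set x := eval_term e s; set y := eval_term e t.
  set x' := eval_term e' s; set y' := eval_term e' t.
  have -> : x ** y - x' ** y' = x ** (y - y') + (x - x') ** y'.
    by rewrite smulBl smulBr addrA subrK.
  rewrite (le_trans (cnormD _ _))// mulrDl -mulrA (mulrAC M) lerD//.
    by rewrite (le_trans (cnormM _ _))// ler_pM ?cnorm_ge0 ?sB ?tN.
  by rewrite (le_trans (cnormM _ _))// ler_pM ?cnorm_ge0 ?sM ?tC.
- by exists N => // e e' d er e'r d0 ed; rewrite -starB cnorm_star tN.
Qed.

Lemma in_ball_cons n (r q : R) (x : A) (e : 'I_n -> A) :
  cnorm x <= q -> in_ball r e -> in_ball (Num.max r q) (env_cons x e).
Proof.
move=> xq er i; rewrite /env_cons; case: unlift => [j|].
  by rewrite (le_trans (er j))// le_max lexx.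
by rewrite (le_trans xq)// le_max lexx orbT.
Qed.

Lemma env_cons_dist n (x y : A) (e e' : 'I_n -> A) (d : R) :
  cnorm (x - y) <= d -> (forall i, cnorm (e i - e' i) <= d) ->
  forall i, cnorm (env_cons x e i - env_cons y e' i) <= d.
Proof. by move=> xy ee' i; rewrite /env_cons; case: unlift. Qed.

(** The modulus of [phi] on the larger ball works unchanged, since the same [x] can be used on both
    sides. *)
Lemma bounded_unif_sup n (r q : R) (phi : ('I_n.+1 -> A) -> R) : 0 < q ->
  bounded_unif (Num.max r q) phi ->
  bounded_unif r (fun e =>
    sup [set phi (env_cons x e) | x in [set x : A | cnorm x <= q]]).
Proof.
move=> q0  [[M fM] fu].
have ne : [set x : A | cnorm x <= q] !=set0 by exists 0; rewrite /= cnorm0 ltW.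
have bd e x : in_ball r e -> cnorm x <= q -> `|phi (env_cons x e)| <= M.
  by move=> er xq; apply: fM; apply: in_ball_cons.
have ub e : in_ball r e ->
  has_ubound [set phi (env_cons x e) | x in [set x : A | cnorm x <= q]].
  move=> er; exists M => _ [x /= xq <-];
    exact: le_trans (ler_norm _) (bd e x er xq).
split.
  exists M => e er; have := bd e 0 er; rewrite cnorm0 => /(_ (ltW q0)) b0.
  rewrite ler_norml; apply/andP; split.
    rewrite (le_trans (_ : - M <= phi (env_cons 0 e)))//.
      by move: b0; rewrite ler_norml => /andP[].
    by apply: ub_le_sup; [exact: ub|exists 0 => //=; rewrite cnorm0 ltW].
  apply: ge_sup; first by have [x xq] := ne; exists (phi (env_cons x e)), x.
  by move=> _ [x /= xq <-]; exact: le_trans (ler_norm _) (bd e x er xq).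
move=> h h0; have [d d0 fd] := fu _ h0; exists d => // e e' er e'r ed.
have half e1 e2 : in_ball r e1 -> in_ball r e2 ->
    (forall i, cnorm (e1 i - e2 i) <= d) ->
    sup [set phi (env_cons x e1) | x in [set x : A | cnorm x <= q]] <=
    sup [set phi (env_cons x e2) | x in [set x : A | cnorm x <= q]] + h.
  move=> e1r e2r e12; apply: sup_le_approx => //; first exact: ub.
  move=> x /= xq; exists x => //; rewrite -lerBlDl (le_trans (ler_norm _))//.
  apply: fd; try exact: in_ball_cons.
  by apply: env_cons_dist => //; rewrite subrr cnorm0 ltW.
rewrite ler_norml lerNl opprB !lerBlDl half ?half// => i.
by rewrite -cnormN opprB.
Qed.

Lemma bounded_unif_opp n (r : R) (phi : ('I_n -> A) -> R) :
  bounded_unif r phi -> bounded_unif r (fun e => - phi e).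
Proof.
move=> [[M fM] fu]; split; first by exists M => e er; rewrite normrN fM.
move=> h /fu[d d0 fd]; exists d => // e e' er e'r ed.
by rewrite -opprD normrN fd.
Qed.

(** Induction with [r] arbitrary, as passing under a quantifier enlarges the radius to
    [Num.max r q]. *)
Lemma eval_formula_bounded_unif n (f : formula R n) (r : R) :
  bounded_unif r (eval_formula (A := A) f).
Proof.
elim: f r => {n} [n t|n k u cu f IH|n q f IH|n q f IH] r /=.
- split.
    have [M _ tM] := eval_term_bounded t r.
    by exists M => e er; rewrite ger0_norm ?cnorm_ge0 ?tM.
  move=> h h0; have [K K0 tK] := eval_term_lipschitz t r.
  have K10 : 0 < K + 1 by rewrite ltr_wpDl.
  exists (h / (K + 1)) => [|e e' er e'r ed]; first by rewrite divr_gt0.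
  have d0 : 0 <= h / (K + 1) by rewrite ltW ?divr_gt0.
  have lip e1 e2 : in_ball r e1 -> in_ball r e2 ->
      (forall i, cnorm (e1 i - e2 i) <= h / (K + 1)) ->
      cnorm (eval_term (A := A) e1 t) - cnorm (eval_term e2 t) <= h.
    move=> e1r e2r e12; rewrite lerBlDl.
    rewrite -{1}[eval_term e1 t](subrK (eval_term e2 t)) addrC (le_trans
      (cnormD _ _))// lerD2l.
    rewrite (le_trans (tK _ _ _ e1r e2r d0 e12))// mulrA ler_pdivrMr// mulrDr
      mulr1 mulrC lerDl; exact: ltW.
  rewrite ler_norml lerNl opprB !lip// => i.
  by rewrite -cnormN opprB.
- have [M fM] : exists M : R, forall i e, in_ball r e -> `|eval_formula (A :=
  A) (f i) e| <= M.
    have /choice[M MP] : forall i, exists M : R, forall e, in_ball r e ->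
      `|eval_formula (A := A) (f i) e| <= M.
      by move=> i; have [] := IH i r.
    exists (\sum_i `|M i|) => i e er; rewrite (le_trans (MP i e er))//.
    by rewrite (le_trans (ler_norm _))// (bigD1 i)//= lerDl sumr_ge0.
  have [[B uB] uu] := continuous_box_bounded_unif M cu.
  split; first by exists B => e er; apply: uB => i; rewrite mxE fM.
  move=> h /uu[d d0 ud].
  (* The bound [d / 2] turns the weak inequality of the induction hypothesis into the strict one
     required by [ud]. *)
  have /choice[dl dlP] : forall i, exists dl : R, 0 < dl /\ forall e e',
      in_ball r e -> in_ball r e' -> (forall i, cnorm (e i - e' i) <= dl) ->
      `|eval_formula (A := A) (f i) e - eval_formula (f i) e'| <= d / 2.
    move=> i; have [_ /(_ (d / 2) (divr_gt0 d0 (ltr0Sn _ 1)))[dl dl0 H]] :=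
      IH i r.
    by exists dl.
  (* The default 1 keeps the minimum positive even for a connective without arguments. *)
  exists (\big[Num.min/1]_i dl i).
    by apply/bigmin_gtP; split=> // i _; exact: (dlP i).1.
  move=> e e' er e'r ed; apply: ud => i; rewrite !mxE ?fM//.
  apply: le_lt_trans (_ : d / 2 < d);
    last by rewrite ltr_pdivrMr// ltr_pMr// ltr1n.
  apply: (dlP i).2 => // j; rewrite (le_trans (ed j))//.
  exact: bigmin_le_cond.
- exact: (@bounded_unif_sup _ r q%:num (eval_formula f)).
- rewrite [X in bounded_unif r X](_ : _ = (fun e =>
  - sup [set - eval_formula f (env_cons x e) | x in [set x : A | cnorm x <=
  q%:num]])); last first.
    by apply/funext => e; rewrite /inf image_comp.
  apply: bounded_unif_opp.
  apply: (@bounded_unif_sup _ r q%:num (fun e => - eval_formula f e)) => //.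
  exact/bounded_unif_opp/IH.
Qed.

End UniformContinuity.
(** * Back and forth *)

(** The empty list in the last clause makes [J] nonempty. *)
Definition directed_order (J : Type) (lt : rel J) :=
  [/\ irreflexive lt, transitive lt &
      forall s : seq J, exists j, all (lt^~ j) s].

(** Otherwise [j] would lie below an element that lies below [j]. Such a [j] provides points where
    all functions stepping on [s] vanish. *)
Lemma directed_order_not_has (J : Type) (lt : rel J) (s : seq J) j :
  directed_order lt -> all (lt^~ j) s -> ~~ has (lt j) s.
Proof.
move=> [irr trans _]; elim: s => //= i s IH /andP[ij /IH /negPf->];
  rewrite orbF.
by apply/negP => ji; have := trans _ _ _ ij ji; rewrite irr.
Qed.

(** The invariant of the back-and-forth: for tuples of step functions, the set of attained value
    vectors determines the value of every formula. *)
Definition same_range (I Z1 Z2 T : Type)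
    (a : I -> Z1 -> T) (b : I -> Z2 -> T) :=
  (forall p, exists q, forall i, a i p = b i q) /\
  (forall q, exists p, forall i, a i p = b i q).

Lemma same_range_sym (I Z1 Z2 T : Type) (a : I -> Z1 -> T) (b : I -> Z2 -> T) :
  same_range a b -> same_range b a.
Proof.
move=> [ab ba]; split=> [q|p].
  by have [p pq] := ba q; exists p => i; rewrite pq.
by have [q pq] := ab p; exists q => i; rewrite pq.
Qed.

Section BackAndForth.
Variables (R : realType) (J1 J2 : Type) (lt1 : rel J1) (lt2 : rel J2).
Hypotheses (dir1 : directed_order lt1) (dir2 : directed_order lt2).

(** Over each value vector of [b], the function [y] must take exactly the values that [x] takes over
    the same vector of [a]. Refining the modulus from [k] to [k * N] cuts every cell of [b] into [N]
    pieces, enough to host all [N] representatives of the cells of [x] and [a]. *)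
Lemma same_range_extend n
    (a : 'I_n -> J1 * nat -> R[i]) (b : 'I_n -> J2 * nat -> R[i])
    (x : J1 * nat -> R[i]) :
  (forall i, step lt1 (a i)) -> (forall i, step lt2 (b i)) -> step lt1 x ->
  same_range a b ->
  exists2 y, step lt2 y & same_range (env_cons x a) (env_cons y b).
Proof.
move=> as1 bs2 xs1 [ab ba].
have [s [k [k0 bs]]] := step_tuple bs2.
have xas i : step lt1 (env_cons x a i) by rewrite /env_cons; case: unlift.
have [s1 [k1 [k10 xs]]] := step_tuple xas.
have [irr1 trans1 bd1] := dir1; have [irr2 trans2 bd2] := dir2.
have [j1 s1j] := bd1 s1.
have out1 i : env_cons x a i (j1, 0%N) = 0.
  by have [_ _ ->] := xs i => //; exact: directed_order_not_has.
have [|N [v vP]] := @finite_cells J1 lt1 _ s1 k1 (fun p i =>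
  env_cons x a i p) k10.
  by move=> p q pq; apply/funext => i; have [_ /(_ p q pq)] := xs i.
have N0 : (0 < N)%N by have [r _] := vP (j1, 0%N);
  exact: leq_ltn_trans (ltn_ord r).
(* Between [s] and [js] there is room where [b] vanishes and [y] need not: this is for the values of
   [x] at points where all [a i] vanish. *)
have [j0 sj0] := bd2 s; have [js /= /andP[j0s _]] := bd2 [:: j0].
have out2 q : ~~ lt2 q.1 js -> forall i, b i q = 0.
  move=> qj i; have [_ _ ->] := bs i => //; apply: contra qj.
  elim: (s) sj0 => //= j t IH /andP[jj0 /IH{}IH] /orP[qj|//].
  exact: trans2 qj (trans2 _ _ _ jj0 j0s).
(* [g] picks a value that [x] takes over the vector [V]; it is used when the representative offered
   by [cnt] does not match. *)
have /choice[g gP] : forall V : 'I_n -> R[i], exists z, (exists p, forall i,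
  a i p = V i) ->
    exists p, x p = z /\ forall i, a i p = V i.
  move=> V.
  have [[p pV]|np] := pselect (exists p, forall i, a i p = V i);
    last by exists 0.
  by exists (x p) => _; exists p.
(* As the quotient of q.2 by k varies within a cell of b, cnt runs through all
   representatives v of the cells of (x, a). *)
pose cnt (q : J2 * nat) := v (Ordinal (ltn_pmod (q.2 %/ k) N0)).
pose y q := if lt2 q.1 js then
    if `[< forall i, a i (cnt q) = b i q >] then x (cnt q) else g (b^~ q)
  else 0.
have consP (p : J1 * nat) (q : J2 * nat) : x p = y q -> (forall i,
  a i p = b i q) ->
    forall i, env_cons x a i p = env_cons y b i q.
  by move=> xy pq i; rewrite /env_cons; case: unlift.
exists y.
  exists (js :: s), (k * N)%N; split; first by rewrite muln_gt0 k0.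
    move=> p q [/= [pq spq] kpq]; rewrite /y pq.
    have bpq : b^~ p = b^~ q.
      apply/funext => i; have [_ + _] := bs i; apply; split=> //.
      by have /(congr1 (modn^~ k)) := kpq; rewrite !modn_dvdm ?dvdn_mulr.
    have -> : cnt p = cnt q.
      by congr v; apply: val_inj; rewrite /= !modn_divl mulnC kpq.
    have bpq' i : b i p = b i q by have := congr1 (fun h => h i) bpq.
    suff -> : `[< forall i, a i (cnt q) = b i p >] = `[< forall i,
      a i (cnt q) = b i q >] by rewrite bpq.
    by congr asbool; apply: eq_forall => i; rewrite bpq'.
  by move=> p /=; rewrite negb_or => /andP[/negPf pj _]; rewrite /y pj.
split=> [p|q]; last first.
  have [qj|qj] := boolP (lt2 q.1 js); last first.
    exists (j1, 0%N); apply: consP => [|i].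
      by have := out1 ord0; rewrite /env_cons unlift_none /y (negPf qj).
    by have := out1 (lift ord0 i); rewrite /env_cons liftK out2.
  have [e|ne] := pselect (forall i, a i (cnt q) = b i q).
    by exists (cnt q); apply: consP => //; rewrite /y qj; case: asboolP.
  have [p [xp ap]] := gP (b^~ q) (ba q); exists p; apply: consP => //.
  by rewrite /y qj xp; case: asboolP.
have [r hr] := vP p.
have {}hr i : env_cons x a i p = env_cons x a i (v r) by have :=
  congr1 (fun h => h i) hr.
(* A vector attained by [b] only outside [js] is zero, and the zero vector is attained at [j0],
   below [js]. *)
have [q0 q0j apq] : exists2 q, lt2 q.1 js & forall i, a i p = b i q.
  have [q pq] := ab p; have [qj|qj] := boolP (lt2 q.1 js); first by exists q.
  exists (j0, 0%N) => // i; rewrite pq out2//.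
  by have [_ _ ->] := bs i => //; exact: directed_order_not_has.
(* The residue modulo [k] is that of [q0], so [b] is unchanged; the quotient is [r], so [cnt]
   selects [v r]. *)
pose q := (q0.1, (q0.2 %% k + k * r)%N).
have bq i : b i q = b i q0.
  by have [_ + _] := bs i; apply; split=> //=;
    rewrite addnC mulnC modnMDl modn_mod.
have cq : cnt q = v r.
  rewrite /cnt; congr v; apply: val_inj => /=.
  by rewrite addnC mulnC divnMDl// divn_small ?ltn_pmod// addn0 modn_small.
have av i : a i (v r) = b i q.
  by rewrite bq -apq; have := hr (lift ord0 i); rewrite /env_cons liftK.
exists q; apply: consP => [|i]; last by rewrite bq.
rewrite /y q0j cq; case: asboolP => [_|[]] //.
by have := hr ord0; rewrite /env_cons unlift_none.
Qed.

End BackAndForth.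

(** * Elementary equivalence of the step algebras *)

Section ElementaryEquivalence.
Variable R : realType.

(** An approximation within [e] has norm at most [r + e]; scaling by [r / (r + e)] returns it to the
    ball at the cost of another [e]. *)
Lemma step_dense_in_ball (J : Type) (lt : rel J) (x : stepalg R lt) (r d : R) :
  0 < r -> cnorm x <= r -> 0 < d ->
  exists x' : stepalg R lt,
    [/\ step lt x', cnorm x' <= r & cnorm (x - x') <= d].
Proof.
move=> r0 xr d0; pose e := d / 2; have e0 : 0 < e by rewrite divr_gt0.
have re0 : 0 < r + e by rewrite addr_gt0.
have /step_closureP/(_ _ e0)[g gs xg] := valP x.
pose c : R := r / (r + e).
have c0 : 0 <= c by rewrite divr_ge0 ?ltW.
have gre p : cabs (g p) <= r + e.
  rewrite -[g p](subrK (x p)) (le_trans (cabsD _ _))// addrC lerD//.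
    exact: le_trans (le_snorm x p) xr.
  by rewrite cabsB; exact: xg.
have hs : step lt (fun p => c%:C * g p).
  by apply: (@step_map2 _ _ _ (fun z _ => c%:C * z) g g) => //; rewrite mulr0.
exists (Stepalg (step_closure_step hs)); split=> //.
  apply: snorm_le => [|p]; first exact: ltW.
  rewrite /= cabsM cabs_real ger0_norm//.
  rewrite (le_trans (ler_wpM2l c0 (gre p)))// /c divfK// gt_eqF//.
apply: snorm_le => [|p]; first exact: ltW.
rewrite [X in cabs X](_ : _ = x p - c%:C * g p)// (le_trans (cabs_trans (g p) _
  _))//.
rewrite [leRHS]splitr lerD//; first exact: xg.
have -> : g p - c%:C * g p = (e / (r + e))%:C * g p.
  rewrite -[X in X - _]mul1r -mulrBl; congr (_ * _);
    rewrite -(rmorph1 (real_complex R)) -rmorphB.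
  by congr (_%:C); rewrite /c; field; rewrite gt_eqF.
have ed0 : 0 <= e / (r + e) by rewrite divr_ge0 ?ltW.
rewrite cabsM cabs_real ger0_norm// (le_trans (ler_wpM2l ed0 (gre p)))//.
by rewrite divfK ?gt_eqF.
Qed.

Lemma eval_term_pointwise (J1 J2 : Type) (lt1 : rel J1) (lt2 : rel J2) n
    (t : term R n) (a : 'I_n -> stepalg R lt1) (b : 'I_n -> stepalg R lt2) p q :
  (forall i, a i p = b i q) -> eval_term a t p = eval_term b t q.
Proof.
move=> ab; elim: t => [i||s IHs t IHt|c t IHt|s IHs t IHt|t IHt] //=.
- by rewrite [LHS](_ : _ = eval_term a s p + eval_term a t p)// IHs IHt.
- by rewrite [LHS](_ : _ = c * eval_term a t p)// IHt.
- by rewrite IHs IHt.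
- by rewrite IHt.
Qed.

Definition step_env (J : Type) (lt : rel J) n (a : 'I_n -> stepalg R lt) :=
  forall i, step lt (a i).

Definition env_val (J : Type) (lt : rel J) n
    (a : 'I_n -> stepalg R lt) (i : 'I_n) : J * nat -> R[i] := a i.

Lemma env_val_cons (J : Type) (lt : rel J) n
    (x : stepalg R lt) (a : 'I_n -> stepalg R lt) :
  env_val (env_cons x a) = env_cons (x : J * nat -> R[i]) (env_val a).
Proof. by apply/funext => i; rewrite /env_val /env_cons; case: unlift. Qed.

Lemma stepalg_extend (J1 J2 : Type) (lt1 : rel J1) (lt2 : rel J2) n r
    (a : 'I_n -> stepalg R lt1) (b : 'I_n -> stepalg R lt2)
    (x : stepalg R lt1) :
  directed_order lt1 -> directed_order lt2 -> step_env a -> step_env b ->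
  same_range (env_val a) (env_val b) -> step lt1 x -> cnorm x <= r ->
  exists y : stepalg R lt2, [/\ step_env (env_cons y b), cnorm y <= r &
    same_range (env_val (env_cons x a)) (env_val (env_cons y b))].
Proof.
move=> d1 d2 sa sb ab sx xr.
have [y ys xy] := same_range_extend d1 d2 sa sb sx ab.
exists (Stepalg (step_closure_step ys)); split; rewrite ?env_val_cons//.
  by move=> i; rewrite /env_cons; case: unlift.
apply: snorm_le => [|q]; first exact: le_trans (cnorm_ge0 x) xr.
(* Every value of [y] is a value of [x], hence the norm bound is inherited. *)
have [p pq] := xy.2 q; have := pq ord0; rewrite /env_cons unlift_none /= => <-.
exact: le_trans (le_snorm x p) xr.
Qed.

Lemma env_in_ball (A : cstarAlgType R) n (a : 'I_n -> A) :
  exists r : R, in_ball r a.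
Proof.
exists (\sum_i cnorm (a i)) => i; rewrite (bigD1 i)//= lerDl sumr_ge0// => j _.
exact: cnorm_ge0.
Qed.

Section Quantifiers.
Variables (J1 J2 : Type) (lt1 : rel J1) (lt2 : rel J2).
Hypotheses (dir1 : directed_order lt1) (dir2 : directed_order lt2).
Variables (n : nat) (f : formula R n.+1).
Variables (a : 'I_n -> stepalg R lt1) (b : 'I_n -> stepalg R lt2).
Hypotheses (sa : step_env a) (sb : step_env b).
Hypothesis ab : same_range (env_val a) (env_val b).
Hypothesis IH : forall (a' : 'I_n.+1 -> stepalg R lt1) (b' : 'I_n.+1 ->
  stepalg R lt2),
  step_env a' -> step_env b' -> same_range (env_val a') (env_val b') ->
  eval_formula f a' = eval_formula f b'.

(** Replace [x] by a nearby step function [x'] and answer [x'] by [y]: the formula agrees exactly at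
    [x'] and [y], and uniform continuity accounts for moving from [x] to [x']. *)
Lemma approx_extend (r e : R) (x : stepalg R lt1) :
  0 < r -> 0 < e -> cnorm x <= r ->
  exists2 y : stepalg R lt2, cnorm y <= r &
    `|eval_formula f (env_cons x a) - eval_formula f (env_cons y b)| <= e.
Proof.
move=> r0 e0 xr; have [q aq] := env_in_ball a.
have [_ /(_ _ e0)[d d0 fd]] :=
  @eval_formula_bounded_unif R (stepalg R lt1) _ f (Num.max q r).
have [x' [sx' x'r xx']] := step_dense_in_ball r0 xr d0.
have [y [sy yr xy]] := stepalg_extend dir1 dir2 sa sb ab sx' x'r.
exists y => //; rewrite -(IH _ sy xy); last by move=> i; rewrite /env_cons;
  case: unlift.
apply: fd; try exact: in_ball_cons.
by apply: env_cons_dist => // i; rewrite subrr cnorm0 ltW.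
Qed.

Let values_bounded (r : R) :
  exists M : R, forall y : stepalg R lt2, cnorm y <= r ->
  `|eval_formula f (env_cons y b)| <= M.
Proof.
have [q bq] := env_in_ball b.
have [[M fM] _] := @eval_formula_bounded_unif R (stepalg R lt2) _ f (Num.max q
  r).
by exists M => y yr; apply: fM; exact: in_ball_cons.
Qed.

Let ball_nonempty (r : R) :
  0 < r -> [set x : stepalg R lt1 | cnorm x <= r] !=set0.
Proof. by move=> r0; exists 0; rewrite /= cnorm0 ltW. Qed.

(** One inequality is enough, because the other follows by exchanging the two algebras. *)
Lemma eval_sup_le (r : {posnum R}) :
  eval_formula (FSup r f) a <= eval_formula (FSup r f) b.
Proof.
apply/ler_addgt0Pr => e e0; apply: sup_le_approx; first exact: ball_nonempty.
  have [M fM] := values_bounded r%:num.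
  exists M => _ [y /= yr <-]; exact: le_trans (ler_norm _) (fM y yr).
move=> x /= xr; have [//|y yr xy] := approx_extend _ e0 xr; exists y => //.
by rewrite -lerBlDl (le_trans (ler_norm _)).
Qed.

Lemma eval_inf_ge (r : {posnum R}) :
  eval_formula (FInf r f) b <= eval_formula (FInf r f) a.
Proof.
apply/ler_addgt0Pr => e e0; apply: inf_le_approx; first exact: ball_nonempty.
  have [M fM] := values_bounded r%:num.
  exists (- M) => _ [y /= yr <-]; by have := fM y yr; rewrite ler_norml =>
    /andP[].
move=> x /= xr; have [//|y yr xy] := approx_extend _ e0 xr; exists y => //.
by rewrite -lerBlDl (le_trans (ler_norm _))// distrC.
Qed.

End Quantifiers.

(** The norm of a term is a supremum over the joint range of its arguments, which settles atomic
    formulas; the quantifier cases are [eval_sup_le] and [eval_inf_ge] in both directions. *)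
Lemma eval_formula_same_range (J1 J2 : Type) (lt1 : rel J1) (lt2 : rel J2) n
    (f : formula R n) (a : 'I_n -> stepalg R lt1) (b : 'I_n -> stepalg R lt2) :
  directed_order lt1 -> directed_order lt2 -> step_env a -> step_env b ->
  same_range (env_val a) (env_val b) -> eval_formula f a = eval_formula f b.
Proof.
move=> d1 d2; elim: f a b =>
  {n} [n t|n k u cu f IH|n r f IH|n r f IH] a b sa sb ab.
- congr sup; apply/seteqP; split=> _ [p _ <-].
    by have [q pq] := ab.1 p; exists q => //;
      rewrite (eval_term_pointwise t pq).
  by have [q pq] := ab.2 p; exists q => //; rewrite (eval_term_pointwise t pq).
- by rewrite /=; congr u; apply/rowP => i; rewrite !mxE; exact: IH.
- apply/eqP; rewrite eq_le; apply/andP; split; apply: eval_sup_le => //.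
  + exact: same_range_sym.
  + by move=> b' a' sb' sa' /same_range_sym ab'; rewrite (IH a' b').
- apply/eqP; rewrite eq_le; apply/andP; split; apply: eval_inf_ge => //.
  + exact: same_range_sym.
  + by move=> b' a' sb' sa' /same_range_sym ab'; rewrite (IH a' b').
Qed.

Lemma stepalg_elementarily_equivalent (J1 J2 : Type)
    (lt1 : rel J1) (lt2 : rel J2) :
  directed_order lt1 -> directed_order lt2 ->
  elementarily_equivalent (stepalg R lt1) (stepalg R lt2).
Proof.
move=> d1 d2 f; have [_ _ /(_ [::])[j1 _]] := d1; have [_ _ /(_ [::])[j2 _]] :=
  d2.
apply: eval_formula_same_range => //; try by move=> i; exact: step0.
(* Without free variables, equal joint range means only that both index sets are inhabited. *)
by split=> p; [exists (j2, 0%N)|exists (j1, 0%N)] => -[].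
Qed.

End ElementaryEquivalence.
(** * Common units in ultrapowers *)

Lemma countably_directedW (J : Type) (lt : rel J) :
  inhabited J -> countably_directed lt -> directed_order lt.
Proof.
move=> [j0] [irr trans bd]; split=> // s; have [j ju] := bd (nth j0 s).
exists j; elim: s ju => //= i s IH ju; rewrite (ju 0%N) /=.
by apply: IH => n; exact: (ju n.+1).
Qed.

(** The isomorphism invariant that separates the two ultrapowers, with [J1] as index type. *)
Definition common_unit (R : realType) (Q : starAlgType R) (I : Type) :=
  forall x : I -> Q, exists e, forall i, e ** x i = x i.

Lemma common_unit_isomorphic (R : realType) (P Q : starAlgType R) (I : Type) :
  star_isomorphic P Q -> common_unit Q I -> common_unit P I.
Proof.
move=> [f [[g fK gK] fM _]] uQ x; have [e eP] := uQ (f \o x).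
by exists (g e) => i; rewrite -[LHS]fK fM gK [X in g X]eP /= fK.
Qed.

Section StepalgUnits.
Variables (R : realType) (J : Type) (lt : rel J).
Notation A := (stepalg R lt).

Lemma step_initial (j : J) : step lt (fun p => (lt p.1 j)%:R : R[i]).
Proof.
exists [:: j], 1%N; split=> // [p q [/= [->]]//|p /=].
by rewrite orbF => /negPf->.
Qed.

Definition initial_unit (j : J) : A :=
  Stepalg (step_closure_step (step_initial j)).

Hypotheses (inh : inhabited J) (cdir : countably_directed lt).

(** An approximation within [n.+1%:R^-1] vanishes off a bounded set; countable directedness bounds
    these bounds for all [n] together. *)
Lemma stepalg_support (a : A) : exists j, forall p, ~~ lt p.1 j -> a p = 0.
Proof.
have [irr trans bd] := cdir; have [_ _ fbd] := countably_directedW inh cdir.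
have /choice[u uP] : forall n : nat, exists j, forall p, ~~ lt p.1 j ->
  cabs (a p) <= n.+1%:R^-1.
  move=> n; have n0 : 0 < n.+1%:R^-1 :> R by rewrite invr_gt0.
  have /step_closureP/(_ _ n0)[g [s [k [_ _ g0]]] ag] := valP a.
  have [j sj] := fbd s; exists j => p pj.
  have := ag p; rewrite g0 ?subr0//; apply: contra pj.
  by elim: s sj {g0} => //= i s IH /andP[ij /IH{}IH] /orP[/trans/(_ ij)|].
have [j uj] := bd u; exists j => p pj; apply: cabs_eq0; apply/eqP.
rewrite eq_le cabs_ge0 andbT; apply/ler_addgt0Pr => e e0; rewrite add0r.
have [n ne] : exists n : nat, n.+1%:R^-1 < e.
  by have [n ne] := filter_ex (near_infty_natSinv_lt (PosNum e0)); exists n.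
rewrite (le_trans _ (ltW ne))// uP//; apply: contra pj => pu.
exact: trans pu (uj n).
Qed.

Lemma initial_unitM (a : A) (j : J) :
  (forall p, ~~ lt p.1 j -> a p = 0) -> initial_unit j ** a = a.
Proof.
move=> a0; apply: stepalg_eq => p /=.
by case: (boolP (lt p.1 j)) => [_|/a0->]; rewrite ?mul1r ?mulr0.
Qed.

Lemma const_bounded (a : A) : (fun _ : nat => a) \in @bounded_seq R A.
Proof. by apply/bounded_seqP; exists (cnorm a). Qed.

Definition const_linfty (a : A) : linfty A := Linfty (const_bounded a).

(** Each representing sequence has its supports below one index, by countable directedness, and
    [bdI] bounds these indices by a single [j]. The constant sequence at [initial_unit j] is then a
    unit in every coordinate. *)
Lemma ultrapower_common_unit (U : set_system nat) (FU : UltraFilter U)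
    (I : Type) :
  (forall u : I -> J, exists j, forall i, lt (u i) j) ->
  common_unit (ultrapower A FU) I.
Proof.
move=> bdI x; have [irr trans bd] := cdir.
have /choice[u uP] : forall i, exists j, forall n p, ~~ lt p.1 j ->
  repr (x i) n p = 0.
  move=> i; have /choice[v vP] := fun n => stepalg_support (repr (x i) n).
  have [j vj] := bd v; exists j => n p pj; apply: vP; apply: contra pj => pv.
  exact: trans pv (vj n).
have [j uj] := bdI u.
exists (\pi_(ultrapower A FU) (const_linfty (initial_unit j))) => i.
rewrite -[x i]reprK.
have mulE := Defs.pi_mul FU (const_linfty (initial_unit j)) (repr (x i)).
apply: etrans mulE _; congr (\pi_(ultrapower A FU) _).
apply: linfty_eq => n; apply: initial_unitM => p pj; apply: uP.
by apply: contra pj => /trans; exact.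
Qed.

(** The supports of a representative of [e] lie below some [j]. For [i] above [j], at the point
    [(j, 0)] every coordinate of [e] is 0 while [initial_unit i] is 1, so [e] fails on
    [initial_unit i] by distance at least 1 in every coordinate. *)
Lemma ultrapower_no_common_unit (U : set_system nat) (FU : UltraFilter U) :
  ~ common_unit (ultrapower A FU) J.
Proof.
move=> /(_ (fun j =>
  \pi_(ultrapower A FU) (const_linfty (initial_unit j))))[e eP].
have [irr trans bd] := cdir.
have /choice[v vP] := fun n => stepalg_support (repr e n).
have [j vj] := bd v; have [i ji] := bd (fun=> j).
have mulE := Defs.pi_mul FU (repr e) (const_linfty (initial_unit i)).
have := eP i; rewrite -{1}[e]reprK => /(etrans (esym mulE)).
move=> /ultrapower_eqP/null_seqP/(_ 1 ltr01).
set S := (X in U X); suff -> : S = set0 by apply: filter_not_empty.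
apply/seteqP; split=> // n /=; apply/negP; rewrite -leNgt.
have := le_snorm (repr e n ** initial_unit i - initial_unit i) (j, 0%N).
apply: le_trans.
have e0 : repr e n (j, 0%N) = 0.
  apply: vP; apply/negP => /= jv; have := trans _ _ _ jv (vj n); by rewrite irr.
by rewrite [X in cabs X](_ : _ = repr e n (j,
  0%N) * (lt j i)%:R - (lt j i)%:R)// e0 (ji 0%N) mul0r sub0r cabsN /cabs
  normr1.
Qed.

End StepalgUnits.
(** * Density character *)


(** A dense set of least cardinality exists by [least_cardinal], applied to the family of all dense
    sets. *)
Lemma density_le_continuum_dense (T : topologicalType) (E : set T) :
  dense E -> E #<= [set: set nat] -> density_le_continuum T.
Proof.
move=> dE Ec.
have [[D dD] Dmin] :=
  @least_cardinal {D : set T | dense D} (exist _ E dE) (fun D => sval D).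
have DE (F : set T) : dense F -> D #<= F.
  move=> dF; apply: (card_le_trans (card_le_setT D)).
  apply: (card_le_trans (Dmin (exist _ F dF))) => /=.
  by have := card_setT F; rewrite card_eq_le => /andP[].
by exists D; [split|exact: card_le_trans (DE _ dE) Ec].
Qed.

(** With elements of [J] read as sets of naturals, a list is coded by the disjoint union of its
    entries, a subset of a countable type. *)
Lemma card_seq_continuum (J : Type) (C : countType) :
  [set: J] #<= [set: set nat] -> [set: seq J * C] #<= [set: set nat].
Proof.
move=> /card_leT_injP[f finj]; apply/card_leT_injP.
(* The length is recorded because [nth] pads with [set0], which may also be a genuine entry. *)
pose B (u : seq J * C) : set ((nat * nat) + (nat * C)) := fun t => match t with
  | inl (i, n) => nth set0 (map f u.1) i n
  | inr (m, c) => m = size u.1 /\ c = u.2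
  end.
have Binj u v : B u = B v -> u = v.
  move=> e; have eq t : B u t = B v t by rewrite e.
  have [es ec] : size u.1 = size v.1 /\ u.2 = v.2.
    by have : B u (inr (size u.1, u.2)) by []; rewrite eq.
  case: u v es ec e eq => [s c] [t d] /= es -> e eq; congr (_, _).
  apply: (inj_map finj); apply: (@eq_from_nth _ set0);
    first by rewrite !size_map.
  by move=> i _; apply/funext => n; exact: (eq (inl (i, n))).
exists (fun u => pickle @` B u) => u v e; apply: Binj.
have sub (X Y : set (nat * nat + nat * C)) : pickle @` X `<=` pickle @` Y ->
  X `<=` Y.
  by move=> XY t Xt; have [t' Yt' /(pcan_inj pickleK)<-] :=
    XY _ (imageP pickle Xt).
by apply/seteqP; split; apply: sub; rewrite e.
Qed.

Section StepalgDensity.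
Variables (R : realType) (J : Type) (lt : rel J).

Definition lookup (K : eqType) (V : Type) (v0 : V) (l : seq (K * V))
    (c : K) : V :=
  head v0 [seq e.2 | e <- l & e.1 == c].

Definition gaussian (z : rat * rat) : R[i] := ratr z.1 +i* ratr z.2.

Lemma gaussian_dense (z : R[i]) (e : R) :
  0 < e -> exists q, cabs (z - gaussian q) <= e.
Proof.
move=> e0; have e20 : 0 < e / 2 by rewrite divr_gt0.
have approx (x : R) : exists q : rat, `|x - ratr q| <= e / 2.
  have [|q] := @rat_in_itvoo R x (x + e / 2); first by rewrite ltrDl.
  rewrite in_itv /= => /andP[xq qx]; exists q.
  rewrite distrC ger0_norm ?subr_ge0; last exact: ltW.
  by rewrite lerBlDl; exact: ltW.
have [a az] := approx (complex.Re z); have [b bz] := approx (complex.Im z).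
exists (a, b); rewrite (le_trans (cabs_ReIm _))// [leRHS]splitr.
by case: z az bz => x y /= az bz; rewrite lerD.
Qed.

Definition cell (s : seq J) (k : nat) (p : J * nat) : seq bool * nat :=
  (map (lt p.1) s, p.2 %% k)%N.

(** The code stores the modulus minus one, so that every code gives a step function. Apart from the
    list in [J] its data are countable. *)
Definition table_fun
    (t : seq J * (nat * seq ((seq bool * nat) * (rat * rat)))) p : R[i] :=
  if has (lt p.1) t.1
  then gaussian (lookup (0, 0) t.2.2 (cell t.1 t.2.1.+1 p)) else 0.

Lemma table_fun_step t : step lt (table_fun t).
Proof.
exists t.1, t.2.1.+1; split=> // [p q [pq kpq]|p /negPf p0];
  last by rewrite /table_fun p0.
rewrite /table_fun /cell pq kpq; suff ->
  : has (lt p.1) t.1 = has (lt q.1) t.1 by [].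
by have := congr1 (has id) pq; rewrite !has_map.
Qed.

Lemma table_fun_dense (f : J * nat -> R[i]) (e : R) : step lt f -> 0 < e ->
  exists t, forall p, cabs (f p - table_fun t p) <= e.
Proof.
move=> [s [[|k] [// _ fs f0]]] e0.
have [|N [v vP]] := @finite_cells J lt _ s k.+1 (cell s k.+1) (ltn0Sn k).
  by move=> p q [pq kpq]; rewrite /cell pq kpq.
have /choice[g gP] := fun z : R[i] => gaussian_dense z e0.
exists (s, (k, [seq (cell s k.+1 (v i), g (f (v i))) | i <- enum 'I_N])) => p.
rewrite /table_fun /=; case: ifPn => [_|ps];
  last by rewrite f0// subrr cabs0 ltW.
set l := map _ _; set c := cell s k.+1 p.
have [i ci] := vP p.
have : [seq e.2 | e <- l & e.1 == c] != [::].
  rewrite -size_eq0 size_map size_filter -lt0n -has_count; apply/hasP.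
  exists (cell s k.+1 (v i), g (f (v i))); last by rewrite /= /c ci.
  by apply/mapP; exists i => //; rewrite mem_enum.
(* The first matching entry may stem from another representative [v j] of the same cell, where [f]
   takes the same value. *)
rewrite /lookup; case E : [seq _ | _ <- _ & _] => [|w ws] //= _.
have : w \in [seq e.2 | e <- l & e.1 == c] by rewrite E mem_head.
move=> /mapP[[c' w']]; rewrite mem_filter => /andP[/= /eqP->
  ] /mapP[j _ [e1 e2 ->]] ->.
have <- : f (v j) = f p by apply: fs; split; rewrite ?e1 ?e2.
exact: gP.
Qed.

Lemma stepalg_density : [set: J] #<= [set: set nat] ->
  density_le_continuum (stepalg R lt).
Proof.
move=> Jc; pose G t : stepalg R lt :=
  Stepalg (step_closure_step (table_fun_step t)).
apply: (@density_le_continuum_dense _ (range G)); last first.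
  by apply: (card_le_trans (card_image_le G _)); exact: card_seq_continuum.
move=> O [x Ox] oO; have := open_nbhs_nbhs (conj oO Ox).
move=> /nbhs_ballP[e /= e0].
have [{}e0 ->] : 0 < complex.Re e /\ e = (complex.Re e)%:C.
  by case: e e0 => a b; rewrite ltcE => /andP[/eqP/= -> ].
set d := complex.Re e in e0 *; rewrite stepalg_ballE => xO.
have d40 : 0 < d / 4 by rewrite divr_gt0.
have /step_closureP/(_ _ d40)[f fs xf] := valP x.
have [t ft] := table_fun_dense fs d40.
exists (G t); split; last by exists t.
apply: xO => /=; apply: le_lt_trans (_ : d / 2 < d);
  last by rewrite ltr_pdivrMr// ltr_pMr// ltr1n.
apply: snorm_le => [|p]; first by rewrite ltW ?divr_gt0.
have -> : d / 2 = d / 4 + d / 4 by lra.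
exact: le_trans (cabs_trans (f p) _ _) (lerD (xf p) (ft p)).
Qed.

End StepalgDensity.

Theorem theorem1p3 (R : realType) (notCH : aleph1_lt_continuum) :
  exists A B : cstarAlgType R,
    [/\ density_le_continuum A,
        density_le_continuum B,
        elementarily_equivalent A B &
        forall (U V : set_system nat) (FU : UltraFilter U) (FV : UltraFilter V),
          nonprincipal U -> nonprincipal V ->
          ~ star_isomorphic (ultrapower A FU) (ultrapower B FV)].
Proof.
have [J1 [J2 [lt1 [lt2 [[inh1 inh2 dir1 dir2] [bd c1 c2]]]]]] := index_orders notCH.
exists (stepalg R lt1), (stepalg R lt2); split.
- exact: stepalg_density.
- exact: stepalg_density.
- by apply: stepalg_elementarily_equivalent; exact: countably_directedW.
move=> U V FU FV _ _ iso.
(* An isomorphism would transport common units for [J1]-indexed families, which [bd] provides over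
   [J2], to the ultrapower over [J1]. *)
apply: (ultrapower_no_common_unit (R := R) inh1 dir1 (FU := FU)).
apply: common_unit_isomorphic iso _.
exact: ultrapower_common_unit.
Qed.
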